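(* Let $(\epsilon,\mathbb D,\mathbb S)$ be a Pufferfish instantiation and $M$ a data-release mechanism (with the data-generating process $G$ fixed). Fix some $\theta^*\in\mathbb D$. Let $\mathcal S_{\mathcal X}$ be a partition of $\mathcal X$ such that $P_{\theta^*}(X\in E)$, for $E\in\mathcal S_{\mathcal X}$, is given by a density $p_{\theta^*}(Z=z_E)$ of some marginalisation $Z$ of $X$, and suppose $\mathbb S=\mathcal S_{\mathcal X}\times\mathcal S_{\mathcal X}$. If $M$ satisfies the instantiation $(\epsilon,\mathbb D,\mathbb S)$, then $$P_{\theta^*}(Z\in\cdot\mid T=t)\in N_\epsilon\big(P_{\theta^*}(Z\in\cdot)\big)\qquad( * )$$ for $P(T\in\cdot\mid\theta^* )$-almost all $t\in\mathcal T$. In the other direction, suppose that $P_\theta(X\in E)$, for $E\in\mathcal S_{\mathcal X}$, is given by a density $p_\theta(Z=z_E)$ for all $\theta\in\mathbb D$. If $( * )$ holds with $\theta$ in place of $\theta^*$ for all $\theta\in\mathbb D$ and $P(T\in\cdot\mid\theta)$-almost all $t\in\mathcal T$, then $M$ satisfies the instantiation $(\epsilon,\mathbb D,\mathbb S)$.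
   Context: $(\mathcal X,\mathscr G)$ (data universe) and $(\mathcal T,\mathscr F)$ are measurable spaces, and $\Theta$ is in one-to-one correspondence $\theta\leftrightarrow P_\theta$ with the set of all probability measures on $(\mathcal X,\mathscr G)$. The data-generating process is a map $G:\Theta\times[0,1]\to\mathcal X$ with $G(\theta,\cdot)$ measurable for each $\theta$ and $P_\theta(X\in E)=\lambda(\{u_1\in[0,1]:G(\theta,u_1)\in E\})$ for $E\in\mathscr G$ ($X=G(\theta,U_1)$, $\lambda$ Lebesgue measure). A data-release mechanism is a $(\mathscr G\otimes\mathcal B[0,1],\mathscr F)$-measurable $M:\mathcal X\times[0,1]\to\mathcal T$; $P_x(S)=\lambda(\{u\in[0,1]:M(x,u)\in S\})$. The data-provision procedure outputs $T=M(G(\theta,U_1),U_2)$ with $U_1,U_2$ i.i.d. $\mathrm{Unif}[0,1]$, and $P(T\in S\mid\theta)=\int_{\mathcal X}P_x(S)\,dP_\theta(x)$. $P_\theta(Z\in\cdot\mid T=t)$ denotes the posterior (conditional) distribution of $Z$ given $T=t$ under $X\sim P_\theta$, $T\mid X=x\sim P_x$. For $\theta\in\Theta$ and $E\in\mathscr G$ for which the conditional distribution $P_\theta(X\in\cdot\mid X\in E)$ is well-defined, $\theta|_E\in\Theta$ is the unique parameter with $P_{\theta|_E}(X\in\cdot)=P_\theta(X\in\cdot\mid X\in E)$. (If $P_\theta(X\in E)>0$, this is the elementary conditional probability; if $X=(Y,Z)$ has a canonical density $f(y,z)$ with respect to a product measure $\mu_1\times\mu_2$ and $\{X\in E\}=\{Z=z_E\}$,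 it is the regular conditional probability with $\mu_1$-density $f(y,z_E)/\int f(y',z_E)\,d\mu_1(y')$ if the denominator is positive, and an arbitrary fixed $\mu_1$-density otherwise.) Only pairs for which these conditionals are well-defined are considered. A Pufferfish instantiation $(\epsilon,\mathbb D,\mathbb S)$ consists of a set $\mathbb D\subset\Theta$ (attackers), a set $\mathbb S\subset\mathscr G\times\mathscr G$ (pairs of competing conjectures) and $0\le\epsilon\le\infty$. Let $G_{\mathbb D,\mathbb S}$ be the (undirected) graph on $\Theta$ with an edge $(\theta,\theta')$ whenever there exist $\theta^*\in\mathbb D$ and $(E,E')\in\mathbb S$ with $\theta=\theta^*|_E$ and $\theta'=\theta^*|_{E'}$; $d_{\mathbb D,\mathbb S}(\theta,\theta')$ is the length of a shortest path in this graph ($\infty$ if there is none). With $d_{\mathrm{Mult}}(\mu,\nu)=\sup_{S\in\mathscr F}|\ln(\mu(S)/\nu(S))|$ ($0/0=\infty/\infty=1$), $M$ satisfies $(\epsilon,\mathbb D,\mathbb S)$ if $d_{\mathrm{Mult}}(P(T\in\cdot\mid\theta),P(T\in\cdot\mid\theta'))\le\epsilon\,d_{\mathbb D,\mathbb S}(\theta,\theta')$ for all $\theta,\theta'\in\Theta$, where $0\times\infty=\infty$. ''$P_\theta(X\in E)$, for $E\in\mathcal S_{\mathcal X}$, is given by a density $p_\theta(Z=z_E)$ of some marginalisation $Z$ of $X$'' means: $Z$ is a measurable function of $X$ (for example a sub-vector of the records of $X$) such that each $E\in\mathcal S_{\mathcal X}$ is a level set $\{X\in E\}=\{Z=z_E\}$,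 the law $P_\theta(Z\in\cdot)$ has density $p_\theta(Z=\cdot)$ with respect to a $\sigma$-finite measure, and the prior plausibility of the conjecture $X\in E$ is expressed by the value $p_\theta(Z=z_E)$. Density ratio neighbourhood: for a $\sigma$-finite measure $\mu$ on a measurable space and $r\ge0$, $N_r(\mu)$ is the set of $\sigma$-finite measures $\nu$ on that space with $d_{\mathrm{DR}}(\mu,\nu)\le r$, where $d_{\mathrm{DR}}(\mu,\nu)=0$ if $\mu=\nu=0$; else, if $\mu,\nu$ are mutually absolutely continuous with densities $f,g$ with respect to a common dominating $\sigma$-finite measure $\tau$, $d_{\mathrm{DR}}(\mu,\nu)=\operatorname{ess\,sup}_{t,t'\in\mathcal T^{\mathrm o}}\ln\left(\frac{f(t)}{f(t')}\Big/\frac{g(t)}{g(t')}\right)$, with essential supremum with respect to $\tau$ and $\mathcal T^{\mathrm o}=\{t:0<f(t),g(t)<\infty\}$; and $d_{\mathrm{DR}}(\mu,\nu)=\infty$ otherwise. (In the theorem the underlying space is the range of $Z$.)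
   Formalization: The converse fails at null levels of Z. It is proved when each conditional has P_θ(E)>0 or output probabilities within the essential range over levels; otherwise, for countably generated T, after discarding null conditionals. The posterior in ( * ) is taken up to versions. *)

(* Defs.v *)
From HB Require Import structures.
From mathcomp Require Export all_boot all_order all_algebra.
From mathcomp Require Export all_classical all_reals all_analysis.
From mathcomp Require Export measurable_realfun ess_sup_inf.

Set Implicit Arguments.
Unset Strict Implicit.
Unset Printing Implicit Defensive.
Import Order.TTheory GRing.Theory Num.Theory.

Local Open Scope classical_set_scope.
Local Open Scope ring_scope.
Local Open Scope ereal_scope.

Definition unit_itv (R : realType) : set R := `[0%R, 1%R].
Arguments unit_itv : clear implicits.

Section Model.
Context (R : realType) (dX : measure_display) (X : measurableType dX)
  (Theta : Type).

(* Measures of type [probability X R] that agree on all measurable sets need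
   not be Leibniz-equal, so the correspondence theta <-> P_theta is stated on
   measurable sets. *)
Definition parametrization (P : Theta -> probability X R) : Prop :=
  (forall theta theta',
     (forall A, measurable A -> P theta A = P theta' A) -> theta = theta') /\
  (forall Q : probability X R, exists theta,
     forall A, measurable A -> P theta A = Q A).

(* [G theta u] and [M x u] below are only ever looked at for u in [0, 1]. *)
Definition data_generating (P : Theta -> probability X R)
    (G : Theta -> R -> X) : Prop :=
  forall theta,
    measurable_fun (unit_itv R) (G theta) /\
    forall E, measurable E ->
      P theta E = lebesgue_measure (unit_itv R `&` G theta @^-1` E).

End Model.

Section Mechanism.
Context (R : realType) (dX dT : measure_display)
  (X : measurableType dX) (T : measurableType dT).

Record mechanism := Mechanism {
  mech :> X -> R -> T ;
  measurable_mech :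
    measurable_fun ([set: X] `*` unit_itv R) (fun xu => mech xu.1 xu.2)
}.

Definition release_law (M : mechanism) (x : X) (S : set T) : \bar R :=
  lebesgue_measure (unit_itv R `&` M x @^-1` S).

Definition output_law (M : mechanism) (P : probability X R) (S : set T)
  : \bar R := \int[P]_x release_law M x S.

Let measurable_unit_itv : measurable (unit_itv R).
Proof. exact: measurable_itv. Qed.

Let graph (M : mechanism) (S : set T) : set (X * R) :=
  ([set: X] `*` unit_itv R) `&` (fun xu => M xu.1 xu.2) @^-1` S.

Let measurable_graph (M : mechanism) S : measurable S -> measurable (graph M S).
Proof.
by move=> mS; apply: (measurable_mech M) => //; exact: measurableX.
Qed.

Let release_lawE M x S :
  release_law M x S = (lebesgue_measure \o xsection (graph M S)) x.
Proof.
rewrite /release_law /=; congr (_ _); apply/seteqP; split => u.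
- by move=> [? ?]; rewrite /xsection/= inE /graph/=.
- by rewrite /xsection/= inE /graph/= => -[[_ ?] ?].
Qed.

Let measurable_slice (M : mechanism) x S : measurable S ->
  measurable (unit_itv R `&` M x @^-1` S : set R).
Proof.
move=> mS.
rewrite [X in measurable X](_ : _ = xsection (graph M S) x); last first.
  apply/seteqP; split => u; first by move=> [? ?]; rewrite /xsection/= inE.
  by rewrite /xsection/= inE /graph/= => -[[_ ?] ?].
by apply: measurable_xsection; exact: measurable_graph.
Qed.

Lemma measurable_release_law (M : mechanism) S : measurable S ->
  measurable_fun [set: X] (fun x => release_law M x S).
Proof.
move=> mS; rewrite (_ : (fun x => release_law M x S) =
  lebesgue_measure \o xsection (graph M S)); last first.
  by apply/funext => x; exact: release_lawE.
by apply: measurable_fun_xsection; exact: measurable_graph.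
Qed.

Let release_law0 M x : release_law M x set0 = 0.
Proof. by rewrite /release_law preimage_set0 setI0 measure0. Qed.

Let release_law_ge0 M x S : 0 <= release_law M x S.
Proof. exact: measure_ge0. Qed.

Let release_law_sigma_additive M x : semi_sigma_additive (release_law M x).
Proof.
move=> F mF tF mUF; rewrite /release_law preimage_bigcup setI_bigcupr.
apply: measure_semi_sigma_additive.
- by move=> i; exact: measurable_slice.
- apply: trivIset_setIl; apply/trivIsetP => i j _ _ ij.
  move/trivIsetP : tF => /(_ i j I I ij) Fij.
  by rewrite -preimage_setI Fij preimage_set0.
- by rewrite -setI_bigcupr -preimage_bigcup; exact: measurable_slice.
Qed.

HB.instance Definition _ M x := isMeasure.Build _ _ _ (release_law M x)
  (release_law0 M x) (release_law_ge0 M x) (@release_law_sigma_additive M x).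

Let release_law_setT M x : release_law M x setT = 1.
Proof.
by rewrite /release_law preimage_setT setIT /unit_itv lebesgue_measure_itv/= lte_fin
  ltr01 oppr0 adde0.
Qed.

HB.instance Definition _ M x := Measure_isProbability.Build _ _ _
  (release_law M x) (release_law_setT M x).

Let output_law0 M P : output_law M P set0 = 0.
Proof. by rewrite /output_law integral0_eq. Qed.

Let output_law_ge0 M P S : 0 <= output_law M P S.
Proof. by apply: integral_ge0. Qed.

Let output_law_sigma_additive M P : semi_sigma_additive (output_law M P).
Proof.
move=> F mF tF mUF.
rewrite [X in _ --> X](_ : _ = \sum_(0 <= n <oo) output_law M P (F n)); last first.
  rewrite /output_law -integral_nneseries//; last first.
    by move=> n; exact: measurable_release_law.
  apply: eq_integral => x _; apply/esym/cvg_lim => //.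
  exact: measure_semi_sigma_additive.
exact: is_cvg_nneseries.
Qed.

HB.instance Definition _ M P := isMeasure.Build _ _ _ (output_law M P)
  (output_law0 M P) (output_law_ge0 M P) (@output_law_sigma_additive M P).

Let output_law_setT M P : output_law M P setT = 1.
Proof.
rewrite /output_law (eq_integral (cst 1)); last first.
  by move=> x _; exact: release_law_setT.
by rewrite integral_cst// mul1e; exact: probability_setT.
Qed.

HB.instance Definition _ M P := Measure_isProbability.Build _ _ _
  (output_law M P) (output_law_setT M P).

End Mechanism.

Section Multiplicative_distance.
Context (R : realType) (d : measure_display) (T : measurableType d).

(* 0 / 0 = +oo / +oo = 1; the library has 0^-1 = +oo and +oo^-1 = 0. *)
Definition eratio (a b : \bar R) : \bar R :=
  if (a == 0) && (b == 0) || (a == +oo) && (b == +oo) then 1 else a / b.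

Definition d_mult (mu nu : set T -> \bar R) : \bar R :=
  ereal_sup [set `| lne (eratio (mu S) (nu S)) | | S in measurable].

End Multiplicative_distance.

Section Density_ratio.
Context (R : realType) (d : measure_display) (Z : measurableType d).

Definition has_density (mu tau : set Z -> \bar R) (f : Z -> \bar R) : Prop :=
  [/\ measurable_fun [set: Z] f, forall z, 0 <= f z
    & forall A, measurable A -> mu A = \int[tau]_(z in A) f z].

Definition dr_domain (f g : Z -> \bar R) : set Z :=
  [set z | 0 < f z < +oo /\ 0 < g z < +oo].

(* Values outside dr_domain x dr_domain are irrelevant: there the function is
   -oo, the neutral element of the supremum. *)
Definition dr_sup (tau : {sigma_finite_measure set Z -> \bar R})
    (f g : Z -> \bar R) : \bar R :=
  ess_sup (tau \x tau) (fun zz : Z * Z =>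
    if (zz.1 \in dr_domain f g) && (zz.2 \in dr_domain f g) then
      (ln ((fine (f zz.1) / fine (f zz.2)) /
           (fine (g zz.1) / fine (g zz.2))))%:E
    else -oo).

(* [dr_sup tau f g] does not depend on the choice of the dominating measure and
   of the densities, so the infimum merely selects this common value. *)
Definition d_DR (mu nu : {measure set Z -> \bar R}) : \bar R :=
  if `[< mu setT = 0 /\ nu setT = 0 >] then 0
  else if `[< mu `<< nu /\ nu `<< mu >] then
    ereal_inf [set r | exists (tau : {sigma_finite_measure set Z -> \bar R})
                              (f g : Z -> \bar R),
                 [/\ has_density mu tau f, has_density nu tau g
                   & r = dr_sup tau f g]]
  else +oo.

Definition DR_nbhd (r : \bar R) (mu : {measure set Z -> \bar R})
  : set {measure set Z -> \bar R} :=
  [set nu : {measure set Z -> \bar R} | sigma_finite setT nu /\ d_DR mu nu <= r].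

End Density_ratio.

Section Pufferfish.
Context (R : realType) (dX dT : measure_display)
  (X : measurableType dX) (T : measurableType dT) (Theta : Type).
Variable P : Theta -> probability X R.

(* [c theta E] is theta|_E, and None when the conditional distribution of X
   under P_theta given X \in E is not well-defined. *)
Definition conditioning := Theta -> set X -> option Theta.

Definition elementary_conditioning (c : conditioning) : Prop :=
  forall theta E, measurable E -> 0 < P theta E ->
    exists2 theta', c theta E = Some theta' &
      forall A, measurable A -> P theta' A = P theta (A `&` E) / P theta E.

Definition pf_edge (c : conditioning) (D : set Theta)
    (S : set (set X * set X)) (theta theta' : Theta) : Prop :=
  exists thetas E E', [/\ D thetas, S (E, E'), c thetas E = Some theta
                        & c thetas E' = Some theta'].

Definition pf_path (c : conditioning) (D : set Theta)
    (S : set (set X * set X)) (theta theta' : Theta) (n : nat) : Prop :=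
  exists p : nat -> Theta, [/\ p 0%N = theta, p n = theta'
    & forall i, (i < n)%N ->
        pf_edge c D S (p i) (p i.+1) \/ pf_edge c D S (p i.+1) (p i)].

Definition pf_dist (c : conditioning) (D : set Theta)
    (S : set (set X * set X)) (theta theta' : Theta) : \bar R :=
  ereal_inf [set n%:R%:E | n in pf_path c D S theta theta'].

(* The library has 0 * +oo = 0; here 0 * +oo = +oo. *)
Definition emuloo (a b : \bar R) : \bar R :=
  if (a == +oo) || (b == +oo) then +oo else a * b.

Definition pufferfish (c : conditioning) (eps : \bar R) (D : set Theta)
    (S : set (set X * set X)) (M : mechanism R X T) : Prop :=
  forall theta theta',
    d_mult (output_law M (P theta)) (output_law M (P theta'))
      <= emuloo eps (pf_dist c D S theta theta').

(* [c'] regards as not well-defined some conditionals on events that have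
   probability zero under the parameter at hand. Posteriors cannot see such
   events: if P_theta (Z = z0) = 0, a mechanism that only releases whether
   Z = z0 leaves almost every posterior of Z equal to its prior, although it
   separates theta|_{Z = z0} from every other conditional. *)
Definition discards_null (c c' : conditioning) : Prop :=
  forall theta E, c' theta E = c theta E \/
                  (c' theta E = None /\ P theta E = 0).

End Pufferfish.

Section Marginalisation.
Context (R : realType) (dX dT dZ : measure_display) (X : measurableType dX)
  (T : measurableType dT) (Zs : measurableType dZ) (Theta : Type).
Variables (P : Theta -> probability X R) (c : conditioning X Theta)
  (Z : {mfun X >-> Zs}).

Definition fibre (z : Zs) : set X := Z @^-1` [set z].

(* For each level {Z = z} at which it is well-defined, P_(theta|_{Z = z}) is
   the value at z of one regular conditional distribution of X given Z. *)
Definition regular_conditioning (theta : Theta) : Prop :=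
  exists k : R.-pker Zs ~> X,
    [/\ forall A B, measurable A -> measurable B ->
          P theta (A `&` Z @^-1` B)
            = \int[distribution (P theta) Z]_(z in B) k z A,
        forall x theta', c theta (fibre (Z x)) = Some theta' ->
          forall A, measurable A -> P theta' A = k (Z x) A
      & {ae P theta, forall x, c theta (fibre (Z x)) <> None}].

(* The level sets of Z in [SX] receive their prior plausibility from a density
   of Z, and are conditioned on through Z. *)
Definition given_by_density (SX : set (set X)) (theta : Theta) : Prop :=
  [/\ forall E, SX E -> exists z, E = fibre z,
      exists (mu : {sigma_finite_measure set Zs -> \bar R}) (p : Zs -> \bar R),
        has_density (distribution (P theta) Z) mu p
    & regular_conditioning theta].

(* Q t (A) is P_theta(Z \in A | T = t): both sides are
   P_theta(Z \in A, T \in B). *)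
Definition is_posterior (M : mechanism R X T) (theta : Theta)
    (Q : R.-pker T ~> Zs) : Prop :=
  forall A B, measurable A -> measurable B ->
    \int[output_law M (P theta)]_(t in B) Q t A
      = \int[P theta]_(x in Z @^-1` A) release_law M x B.

Definition posterior_in_nbhd (M : mechanism R X T) (eps : \bar R)
    (theta : Theta) (Q : R.-pker T ~> Zs) : Prop :=
  {ae output_law M (P theta), forall t,
     DR_nbhd eps (distribution (P theta) Z) (Q t)}.

(* The output probabilities under theta' = theta|_{Z = z} lie between the
   essential infimum and the essential supremum, over P_theta-almost all levels,
   of the output probabilities under theta|_{Z = .}. This holds for instance if
   these depend continuously on the level and the law of Z has full support. *)
Definition unexceptional (M : mechanism R X T) (theta theta' : Theta) : Prop :=
  forall (B : set T) (a : \bar R), measurable B ->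
    ({ae P theta, forall x, forall theta'',
        c theta (fibre (Z x)) = Some theta'' ->
        output_law M (P theta'') B <= a} -> output_law M (P theta') B <= a) /\
    ({ae P theta, forall x, forall theta'',
        c theta (fibre (Z x)) = Some theta'' ->
        a <= output_law M (P theta'') B} -> a <= output_law M (P theta') B).

End Marginalisation.

Definition countably_generated (d : measure_display) (T : measurableType d)
  : Prop :=
  exists F : nat -> set T, @measurable _ T = <<s range F >>.

(* Main.v *)
Require Import Defs.
From HB Require Import structures.
From mathcomp Require Import lra ring.

(** Let [pi] be the prior law of [Z] and let [L z] be the law of the output when
    [X] has the conditional law given [Z = z] ([level_law]). The law of [(Z, T)]
    is then [pi (dz) L z (dt)] ([integral_release_law]), and both the guarantee
    and the bound on the posterior say that the laws [L z] dominate each other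
    up to the factor [C = expR eps]. The case [eps = +oo] is trivial.

    From the guarantee to the posterior. Two levels of [Z] at which the
    conditional is defined are joined by an edge, so [L z B <= C * L z' B] for
    all output events [B] ([pufferfish_edge_bound]). Hence the joint law is
    absolutely continuous with respect to the product of its marginals; let
    [h (z, t)] be its density. Drawing two independent levels [z], [z'] and an
    output at one of them shows that [h (z', t) <= C * h (z, t)] almost
    everywhere ([joint_density_ratio]). As [h (., t)] is the density with respect
    to the prior of a version of the posterior given [T = t], this version is
    within [eps] of the prior ([posterior_version]). If the levels have a
    countably generated sigma-algebra, all versions agree almost surely
    ([is_posterior_unique]).

    From the posterior to the guarantee. If the posterior is within [eps] of the
    prior, then for all sets of levels [A], [A'] the ratio of posterior to prior
    probability of [A'] is at most [C] times that of [A] ([d_DR_cross]).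
    Integration over [T \in B] turns this into a comparison of the averages of
    [L z B] over [A] and over [A'] ([posterior_cross]), so the essential supremum
    of [L z B] over [z] is at most [C] times its essential infimum
    ([unexceptional_output_law_le]). The conditionals at the ends of an edge obey
    these essential bounds if their conditioning events have positive
    probability or if they are unexceptional. In general almost every
    conditional obeys them simultaneously on a countable algebra of events; when
    this algebra generates all output events, the domination extends to the
    latter by a monotone class argument ([measure_le_algebra]), and it suffices
    to discard null many null conditionals. The domination along edges
    multiplies along paths ([pf_path_bound]). *)

Set Implicit Arguments.
Unset Strict Implicit.
Unset Printing Implicit Defensive.
Import Order.TTheory GRing.Theory Num.Theory.
Import numFieldNormedType.Exports.
Local Open Scope classical_set_scope.
Local Open Scope ring_scope.
Local Open Scope ereal_scope.

(** * Almost-everywhere statements and products *)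

Section almost_everywhere.
Context d (T : measurableType d) (R : realType) (mu : {measure set T -> \bar R}).

Lemma ae_notin (A : set T) : measurable A -> mu A = 0 -> {ae mu, forall x, ~ A x}.
Proof. by move=> mA A0; exists A; split => // x /= /contrapT. Qed.

Lemma ge0_integral_eq0_ae (f : T -> \bar R) :
  measurable_fun [set: T] f -> (forall x, 0 <= f x) ->
  \int[mu]_x f x = 0 -> {ae mu, forall x, f x = 0}.
Proof.
move=> mf f0 If; have /(ae_eq_integral_abs mu measurableT mf) : \int[mu]_x `|f x| = 0.
  by rewrite -[RHS]If; apply: eq_integral => x _; rewrite gee0_abs.
by apply: filterS => x; exact.
Qed.

(** A set on which [g < f], although the integral of [f] over it does not exceed
    that of [g], is negligible. *)
Lemma measure0_lt_integral (E : set T) (f g : T -> \bar R) :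
  measurable E -> mu.-integrable E f -> mu.-integrable E g ->
  (forall x, E x -> f x \is a fin_num /\ g x \is a fin_num) ->
  (forall x, E x -> g x < f x) ->
  \int[mu]_(x in E) f x <= \int[mu]_(x in E) g x -> mu E = 0.
Proof.
move=> mE fi gi fg gf Ifg.
have I0 : \int[mu]_(x in E) (f \- g) x = 0.
  apply/eqP; rewrite eq_le; apply/andP; split.
    rewrite integralB// leeBlDr ?add0e//.
    by apply: integrable_fin_num.
  apply: integral_ge0 => x Ex /=; have [fx gx] := fg _ Ex.
  by rewrite sube_ge0 ?gx// ltW// gf.
have mfg : measurable_fun E (f \- g).
  by apply: emeasurable_funB; [exact: measurable_int fi|exact: measurable_int gi].
have : \int[mu]_(x in E) `|(f \- g) x| = 0.
  rewrite -[RHS]I0; apply: eq_integral => x /set_mem Ex.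
  have [fx gx] := fg _ Ex; rewrite gee0_abs//=.
  by rewrite sube_ge0 ?gx// ltW// gf.
move/(ae_eq_integral_abs mu mE mfg) => [N [mN N0 EN]].
apply: (subset_measure0 mE mN _ N0) => x Ex; apply: EN => /= /(_ Ex) /eqP.
have [fx gx] := fg _ Ex.
by rewrite sube_eq ?fin_num_adde_defl// ?add0e; apply/negP; rewrite gt_eqF// gf.
Qed.

End almost_everywhere.

Section sections.
Context d1 d2 (T1 : measurableType d1) (T2 : measurableType d2) (R : realType).
Variables (m1 : {sigma_finite_measure set T1 -> \bar R})
  (m2 : {sigma_finite_measure set T2 -> \bar R}).

Lemma ae_xsection (Q : T1 * T2 -> Prop) : {ae m1 \x m2, forall z, Q z} ->
  {ae m1, forall x, {ae m2, forall y, Q (x, y)}}.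
Proof.
move=> [N [mN N0 QN]].
have := ge0_integral_eq0_ae (measurable_fun_xsection m2 mN) _ N0.
move=> /(_ (fun=> measure_ge0 _ _)); apply: filterS => x Nx0.
exists (xsection N x); split => //; first exact: measurable_xsection.
by move=> y /= Qxy; rewrite /xsection/= inE; exact: QN.
Qed.

Lemma ae_ysection0 (E : set (T1 * T2)) : measurable E -> (m1 \x m2) E = 0 ->
  {ae m2, forall y, m1 (ysection E y) = 0}.
Proof.
move=> mE E0; apply: ge0_integral_eq0_ae => //; first exact: measurable_fun_ysection.
rewrite -[RHS]E0 -[in RHS](setIT E) -integral_indic//.
have mi : measurable_fun [set: T1 * T2] (EFin \o (\1_E : T1 * T2 -> R)).
  by apply/measurable_EFinP; exact: measurable_indic.
rewrite (fubini_tonelli2 _ mi); last by move=> x; rewrite lee_fin.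
by apply: eq_integral => y _; rewrite indic_fubini_tonelli_GE.
Qed.

End sections.

(** * The multiplicative distance along paths of conditionals *)

Section multiplicative_distance.
Context (R : realType) (d : measure_display) (T : measurableType d).

Lemma lne_eratio_le (a b e : R) : (0 <= a)%R -> (0 <= b)%R -> (0 <= e)%R ->
  `|lne (eratio a%:E b%:E)| <= e%:E <->
  (a <= expR e * b /\ b <= expR e * a)%R.
Proof.
move=> a0 b0 e0; have ee := expR_gt0 e; rewrite /eratio/= !eqe orbF.
have [->|an0] := eqVneq a 0%R; have [->|bn0] := eqVneq b 0%R => /=.
- by rewrite ler10 ln1 abse0 lee_fin e0 !mulr0.
- rewrite mul0e le0_lneNy//=; split=> //.
  by rewrite mulr0 => -[_ ble0]; rewrite eq_le ble0 b0 in bn0.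
- rewrite inve0 gt0_muley ?lte_fin ?lt0r ?an0//; split=> //.
  by rewrite mulr0 => -[ale0 _]; rewrite eq_le ale0 a0 in an0.
- have a1 : (0 < a)%R by rewrite lt0r an0.
  have b1 : (0 < b)%R by rewrite lt0r bn0.
  rewrite inver (negbTE bn0) -EFinM lne_EFin ?divr_gt0//.
  rewrite abse_EFin lee_fin ler_norml lnM ?posrE ?invr_gt0// lnV ?posrE//.
  rewrite -[in X in _ <-> X](lnK a1) -[in X in _ <-> X](lnK b1) -!expRD !ler_expR.
  by split=> [/andP[]|[]]; lra.
Qed.

(** The convention [0 / 0 = 1] makes the bound on the distance equivalent to two
    dominations, in which no quotient occurs. *)
Lemma d_mult_leP (mu nu : probability T R) (e : R) : (0 <= e)%R ->
  d_mult mu nu <= e%:E <->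
  forall B, measurable B ->
    mu B <= (expR e)%:E * nu B /\ nu B <= (expR e)%:E * mu B.
Proof.
move=> e0; have bnd B : measurable B ->
    `|lne (eratio (mu B) (nu B))| <= e%:E <->
    mu B <= (expR e)%:E * nu B /\ nu B <= (expR e)%:E * mu B.
  move=> mB; have fmu := fin_num_measure mu _ mB.
  have fnu := fin_num_measure nu _ mB.
  rewrite -(fineK fmu) -(fineK fnu) -!EFinM !lee_fin.
  by apply: lne_eratio_le => //; exact: fine_ge0.
split=> [dmn B mB|h].
  apply/bnd => //; apply: le_trans dmn; apply: ereal_sup_ubound.
  by exists B.
by apply: ge_ereal_sup => _ [B mB <-]; apply/bnd => //; exact: h.
Qed.

End multiplicative_distance.

Section pufferfish_edges.
Context (R : realType) (dX dT : measure_display) (X : measurableType dX)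
  (T : measurableType dT) (Theta : Type) (P : Theta -> probability X R)
  (c : conditioning X Theta) (D : set Theta) (S : set (set X * set X))
  (M : mechanism R X T).

Lemma pufferfishy : pufferfish P c +oo D S M.
Proof. by move=> th th'; rewrite /emuloo eqxx/= leey. Qed.

(** The two laws of the output at the ends of an edge dominate each other, up
    to the factor [C]. *)
Definition edge_bound (C : R) :=
  forall th th', pf_edge c D S th th' -> forall B, measurable B ->
    output_law M (P th) B <= C%:E * output_law M (P th') B /\
    output_law M (P th') B <= C%:E * output_law M (P th) B.

Lemma pf_path_bound (C : R) th th' n : (0 <= C)%R -> edge_bound C ->
  pf_path c D S th th' n -> forall B, measurable B ->
    output_law M (P th) B <= (C ^+ n)%:E * output_law M (P th') B /\
    output_law M (P th') B <= (C ^+ n)%:E * output_law M (P th) B.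
Proof.
move=> C0 hC [p [<- <- pe]] B mB.
elim: n pe => [|n IH] pe; first by rewrite !mul1e.
have {IH}[IH1 IH2] := IH (fun i ilt => pe i (ltnW ilt)).
have [S1 S2] : output_law M (P (p n)) B <= C%:E * output_law M (P (p n.+1)) B /\
    output_law M (P (p n.+1)) B <= C%:E * output_law M (P (p n)) B.
  by case: (pe n (ltnSn n)) => /hC /(_ B mB) [].
have Cn0 : (0 <= C ^+ n)%R by exact: exprn_ge0.
split.
  by rewrite exprSr EFinM -muleA (le_trans IH1)// lee_wpmul2l.
by rewrite exprS EFinM -muleA (le_trans S2)// lee_wpmul2l.
Qed.

Lemma edge_bound_pufferfish (e : R) : (0 <= e)%R -> edge_bound (expR e) ->
  pufferfish P c e%:E D S M.
Proof.
move=> e0 he th th'; rewrite /emuloo/=.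
have [_|doo] := eqVneq (pf_dist R c D S th th') +oo; first by rewrite leey.
have [[n np]|none] := pselect (exists n, pf_path c D S th th' n); last first.
  have E0 : [set n%:R%:E | n in pf_path c D S th th'] = set0 :> set (\bar R).
    by apply/seteqP; split => // y [n np _]; exfalso; apply: none; exists n.
  by rewrite /pf_dist E0 ereal_inf0 eqxx in doo.
have [n0 n0p n0min] : exists2 n0, pf_path c D S th th' n0 &
    forall n, pf_path c D S th th' n -> (n0 <= n)%N.
  have ex : exists n, `[< pf_path c D S th th' n >] by exists n; exact/asboolP.
  exists (ex_minn ex); case: ex_minnP => m /asboolP// mp mmin k kp.
  by apply: mmin; exact/asboolP.
have -> : pf_dist R c D S th th' = n0%:R%:E.
  apply/eqP; rewrite eq_le; apply/andP; split.
    by apply: ereal_inf_lbound; exists n0.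
  by apply: le_ereal_inf_tmp => _ [k kp <-]; rewrite lee_fin ler_nat n0min.
rewrite -EFinM; apply/d_mult_leP; first by rewrite mulr_ge0.
move=> B mB; have := pf_path_bound (expR_ge0 e) he n0p mB.
by rewrite -expRM_natl mulrC.
Qed.

Lemma pufferfish_edge_bound (e : R) : (0 <= e)%R ->
  pufferfish P c e%:E D S M -> edge_bound (expR e).
Proof.
move=> e0 pf th th' edge; apply/d_mult_leP => //.
apply: (le_trans (pf th th')).
have d1 : pf_dist R c D S th th' <= 1.
  apply: ereal_inf_lbound; exists 1%N => //.
  exists (fun i => if i is 0%N then th else th'); split => //.
  by case=> // _; left.
have d0 : 0 <= pf_dist R c D S th th'.
  by apply: le_ereal_inf_tmp => _ [k kp <-]; rewrite lee_fin.
rewrite /emuloo/= ifF.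
  by rewrite -[leRHS]mule1 lee_wpmul2l// lee_fin.
by apply/negbTE; rewrite -ltey (le_lt_trans d1)// ltey.
Qed.

End pufferfish_edges.

(** * Countable generating algebras *)

(** The sets built in [n] rounds of unions and differences from the range of
    [F], [set0] and [setT]. *)
Definition algebra_stage (T : Type) (F : nat -> set T) : nat -> set (set T) :=
  fix stage n := if n is m.+1 then
      stage m `|` (fun AB => AB.1 `|` AB.2) @` (stage m `*` stage m)
              `|` (fun AB => AB.1 `\` AB.2) @` (stage m `*` stage m)
    else range F `|` [set set0; setT].

Lemma countable_setU (T : Type) (A B : set T) :
  countable A -> countable B -> countable (A `|` B).
Proof.
move=> cA cB; rewrite -bigcup2E; apply: bigcup_countable => //.
by move=> [|[|n]] _ //=; exact: countable0.
Qed.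

Section countable_algebra.
Context (T : Type) (F : nat -> set T).

Lemma algebra_stageS m n : (m <= n)%N ->
  algebra_stage F m `<=` algebra_stage F n.
Proof.
elim: n => [|n IH]; first by rewrite leqn0 => /eqP ->.
rewrite leq_eqVlt => /predU1P[-> //|]; rewrite ltnS => /IH mn A /mn An.
by left; left.
Qed.

Lemma countable_algebra_stage n : countable (algebra_stage F n).
Proof.
elim: n => [|n IH] /=.
  apply: countable_setU; first exact: (sub_countable (card_image_le _ _)).
  by apply: countable_setU; exact: countable1.
have IH2 : countable (algebra_stage F n `*` algebra_stage F n).
  exact: countableX.
by do !apply: countable_setU => //; exact: (sub_countable (card_image_le _ _)).
Qed.

(** A countable family generates a countable algebra. *)
Lemma countable_algebra : exists A : nat -> set T,
  [/\ setring (range A), range A setT, range F `<=` range A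
    & forall G : set (set T), setring G -> G setT -> range F `<=` G ->
        range A `<=` G].
Proof.
pose alg := \bigcup_n algebra_stage F n.
have algc : countable alg.
  by apply: bigcup_countable => // n _; exact: countable_algebra_stage.
have algT : alg setT by exists 0%N => //; right; right.
have alg0 : alg set0 by exists 0%N => //; right; left.
have algUD A B : alg A -> alg B -> alg (A `|` B) /\ alg (A `\` B).
  move=> [m _ mA] [n _ nB].
  have A' := algebra_stageS (leq_maxl m n) mA.
  have B' := algebra_stageS (leq_maxr m n) nB.
  split; exists (maxn m n).+1 => //=.
    by left; right; exists (A, B).
  by right; exists (A, B).
have algF : range F `<=` alg by move=> A FA; exists 0%N => //; left.
have /pfcard_geP[alg_empty|[f]] : (alg #<= [set: nat])%card := algc.
  by move: algT; rewrite alg_empty.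
have fE : range f = alg.
  by apply/seteqP; split => [A [n _ <-]|A /(surj (f := f))]; [exact: funS|].
exists f; rewrite fE; split => //.
  by split => // A B aA aB; have [] := algUD A B aA aB.
move=> G [G0 GU GD] GT FG A [n _]; elim: n A => [|n IH] A /=.
  by move=> [/FG//|[->|->]].
move=> [[/IH//|[[B C] /= [/IH GB /IH GC] <-]]|[[B C] /= [/IH GB /IH GC] <-]].
- exact: GU.
- exact: GD.
Qed.

End countable_algebra.

Lemma countably_generated_algebra (d : measure_display) (T : measurableType d) :
  countably_generated T -> exists A : nat -> set T,
    [/\ setring (range A), range A setT, forall n, measurable (A n)
      & measurable `<=` <<s range A >>].
Proof.
move=> [F mF]; have [A [ringA AT FA Amin]] := countable_algebra F.
exists A; split => //.
  move=> n; apply: (Amin measurable) => //.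
    by split => // B C mB mC; [exact: measurableU|exact: measurableD].
  by rewrite mF; exact: sub_gen_smallest.
rewrite mF; apply: smallest_sub; first exact: smallest_sigma_algebra.
by apply: subset_trans FA _; exact: sub_gen_smallest.
Qed.

Section comparison.
Context (R : realType) (d : measure_display) (T : measurableType d).

(** A domination between finite measures may be checked on a generating
    algebra: the sets at which it holds form a monotone class. *)
Lemma measure_le_algebra (mu nu : {finite_measure set T -> \bar R}) (C : R)
    (A : set (set T)) :
  setring A -> A setT -> A `<=` measurable -> measurable `<=` <<s A >> ->
  (forall B, A B -> mu B <= C%:E * nu B) ->
  forall B, measurable B -> mu B <= C%:E * nu B.
Proof.
move=> ringA AT Am gA muA B mB.
pose G := [set B | measurable B /\ mu B <= C%:E * nu B].
suff : <<sr A >> `<=` G.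
  move=> srG; suff /srG[] : <<sr A >> B by [].
  apply: (smallest_sub _ _ (gA _ mB)); last exact: sub_gen_smallest.
  have [sr0 srD srU] : sigma_ring <<sr A >> by exact: smallest_sigma_ring.
  by split => // E srE; apply: srD => //; exact: sub_gen_smallest.
apply: monotone_setring_sub_g_sigma_ring => //; last first.
  by move=> E AE; split; [exact: Am|exact: muA].
split=> E monE GE.
  have mE i : measurable (E i) by have [] := GE i.
  split; first exact: bigcupT_measurable.
  apply: (@lee_cvg_to _ \oo _ _ (mu \o E) (fun n => C%:E * (nu \o E) n)).
  - by apply: nondecreasing_cvg_mu => //; exact: bigcupT_measurable.
  - apply: cvgeZl => //.
    by apply: nondecreasing_cvg_mu => //; exact: bigcupT_measurable.
  - by apply: nearW => n; have [] := GE n.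
have mE i : measurable (E i) by have [] := GE i.
have mI : measurable (\bigcap_i E i) by exact: bigcapT_measurable.
split => //.
apply: (@lee_cvg_to _ \oo _ _ (mu \o E) (fun n => C%:E * (nu \o E) n)).
- by apply: nonincreasing_cvg_mu => //; rewrite ltey_eq fin_num_measure.
- apply: cvgeZl => //.
  by apply: nonincreasing_cvg_mu => //; rewrite ltey_eq fin_num_measure.
- by apply: nearW => n; have [] := GE n.
Qed.

Lemma measure_eq_algebra (mu nu : {finite_measure set T -> \bar R})
    (A : set (set T)) :
  setring A -> A setT -> A `<=` measurable -> measurable `<=` <<s A >> ->
  (forall B, A B -> mu B = nu B) -> forall B, measurable B -> mu B = nu B.
Proof.
move=> ringA AT Am gA muA B mB; apply/eqP; rewrite eq_le.
rewrite -[nu B]mul1e (measure_le_algebra ringA AT Am gA)//=; last first.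
  by move=> E AE; rewrite mul1e muA.
rewrite mul1e -[mu B]mul1e (measure_le_algebra ringA AT Am gA)//=.
by move=> E AE; rewrite mul1e muA.
Qed.

End comparison.

(** * The density-ratio distance *)

Section density_ratio.
Context (R : realType) (d : measure_display) (Z : measurableType d).
Implicit Types (mu nu : {measure set Z -> \bar R})
  (tau : {sigma_finite_measure set Z -> \bar R}) (f g : Z -> \bar R).

Lemma density_ae_fin_num mu tau f : mu [set: Z] = 1 -> has_density mu tau f ->
  {ae tau, forall z, f z \is a fin_num}.
Proof.
move=> mu1 [mf f0 muE].
have fi : tau.-integrable [set: Z] f.
  apply/integrableP; split => //.
  under eq_integral do rewrite gee0_abs//.
  by rewrite -muE// mu1 ltry.
by apply: filterS (integrable_ae measurableT fi) => z; exact.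
Qed.

(** Absolute continuity excludes that the density of [mu] is positive where that
    of [nu] vanishes, so, used in both directions, it leaves almost every point in
    [dr_domain f g] or at a common zero of [f] and [g]. *)
Lemma density_ae_eq0 mu nu tau f g : mu `<< nu ->
  has_density mu tau f -> has_density nu tau g ->
  {ae tau, forall z, g z = 0 -> f z = 0}.
Proof.
move=> /null_content_dominatesP munu [mf f0 muE] [mg g0 nuE].
pose N := [set z | g z = 0].
have mN : measurable N.
  rewrite (_ : N = g @^-1` [set 0])//.
  by rewrite -[_ @^-1` _]setTI; exact: mg.
have nuN : nu N = 0.
  by rewrite nuE//; apply: integral0_eq => z; exact.
have : \int[tau]_(z in N) `|f z| = 0.
  rewrite -(munu N mN nuN) muE//; apply: eq_integral => z _.
  by rewrite gee0_abs.
by move/(ae_eq_integral_abs tau mN (measurable_funTS mf)).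
Qed.

(** The bound on the ratio of the densities at two points, integrated over
    [A] and [A']. *)
Lemma density_cross mu nu tau f g (C : R) : (0 <= C)%R ->
  has_density mu tau f -> has_density nu tau g ->
  {ae tau, forall z, {ae tau, forall z', f z * g z' <= C%:E * (f z' * g z)}} ->
  forall A A', measurable A -> measurable A' ->
    mu A * nu A' <= C%:E * (mu A' * nu A).
Proof.
move=> C0 [mf f0 muE] [mg g0 nuE] fg A A' mA mA'.
have step : {ae tau, forall z, f z * nu A' <= C%:E * (mu A' * g z)}.
  apply: filterS fg => z fgz.
  rewrite nuE// -ge0_integralZl//; last exact: measurable_funTS.
  rewrite muE// -ge0_integralZr//; last exact: measurable_funTS.
  rewrite -ge0_integralZl//; last 2 first.
    by apply: measurable_funTS; apply: emeasurable_funM.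
    by move=> x _; rewrite mule_ge0.
  apply: ae_ge0_le_integral => //.
  - by move=> x _; rewrite mule_ge0.
  - by apply: measurable_funTS; apply: emeasurable_funM.
  - by move=> x _; rewrite mule_ge0// ?mule_ge0// lee_fin.
  - by apply: measurable_funTS; do 2 apply: emeasurable_funM => //.
  - by apply: filterS fgz => x.
rewrite (muE A)// (nuE A)// -ge0_integralZr//; last exact: measurable_funTS.
rewrite -ge0_integralZl//; last exact: measurable_funTS.
rewrite -ge0_integralZl//; last 2 first.
  by apply: measurable_funTS; apply: emeasurable_funM.
  by move=> x _; rewrite mule_ge0.
apply: ae_ge0_le_integral => //.
- by move=> x _; rewrite mule_ge0.
- by apply: measurable_funTS; apply: emeasurable_funM.
- by move=> x _; rewrite mule_ge0// ?mule_ge0// lee_fin.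
- by apply: measurable_funTS; do 2 apply: emeasurable_funM => //.
- by apply: filterS step => x.
Qed.


(** A bound that holds for all factors beyond [C] holds for [C]. *)
Lemma lee_mul_gt (x y : \bar R) (C : R) : (0 <= C)%R -> 0 <= x ->
  x \is a fin_num -> y \is a fin_num ->
  (forall C' : R, (C < C')%R -> x <= C'%:E * y) -> x <= C%:E * y.
Proof.
move=> C0; case: x => // x; case: y => // y; rewrite lee_fin => x0 _ _ h.
rewrite -EFinM lee_fin leNgt; apply/negP => Cyx.
have h1 : (x <= (C + 1) * y)%R by rewrite -lee_fin EFinM h// ltrDl.
have y0 : (0 < y)%R.
  rewrite ltNge; apply/negP => y0; nra.
have : (x <= ((C + x / y) / 2) * y)%R.
  by rewrite -lee_fin EFinM h// midf_lt// ltr_pdivlMr.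
rewrite mulrAC mulrDl divfK ?gt_eqF//; lra.
Qed.

(** The distance bounds the ratio of [mu A / nu A] to [mu A' / nu A'], whatever
    the dominating measure and the densities that almost attain it. *)
Lemma d_DR_cross mu nu (C : R) : (0 < C)%R ->
  mu [set: Z] = 1 -> nu [set: Z] = 1 -> d_DR mu nu <= (ln C)%:E ->
  forall A A', measurable A -> measurable A' ->
    mu A * nu A' <= C%:E * (mu A' * nu A).
Proof.
move=> C0 mu1 nu1; rewrite /d_DR.
have -> : `[< mu setT = 0 /\ nu setT = 0 >] = false.
  by apply/asboolPn; rewrite mu1 => -[/eqP]; rewrite onee_eq0.
case: ifPn => [/asboolP[munu numu] dr|_]; last by rewrite leye_eq.
move=> A A' mA mA'.
have fin (m : {measure set Z -> \bar R}) B : m [set: Z] = 1 -> measurable B -> m B \is a fin_num.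
  move=> m1 mB; rewrite ge0_fin_numE//.
  by rewrite (@le_lt_trans _ _ 1) ?ltry// -m1 le_measure ?inE.
apply: lee_mul_gt;
  [exact: ltW|by rewrite mule_ge0|by rewrite fin_numM ?fin..|].
move=> C' CC'.
have C'0 : (0 < C')%R by exact: lt_trans CC'.
(* The infimum in [d_DR] need not be attained, hence the larger [C']. *)
have : d_DR mu nu < (ln C')%:E.
  rewrite /d_DR.
  have -> : `[< mu setT = 0 /\ nu setT = 0 >] = false.
    by apply/asboolPn; rewrite mu1 => -[/eqP]; rewrite onee_eq0.
  rewrite (asboolT (conj munu numu)); apply: le_lt_trans dr _.
  by rewrite lte_fin ltr_ln ?posrE.
rewrite /d_DR.
have -> : `[< mu setT = 0 /\ nu setT = 0 >] = false.
  by apply/asboolPn; rewrite mu1 => -[/eqP]; rewrite onee_eq0.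
rewrite (asboolT (conj munu numu)).
move=> /ereal_inf_lt[_ [tau [f [g [df dg ->]]]] /ltW drC'].
apply: (density_cross (ltW C'0) df dg) => //.
have [[mf f0 _] [mg g0 _]] := (df, dg).
move: drC' => /ess_supP/ae_xsection sec.
pose ok z := [/\ f z \is a fin_num, g z \is a fin_num & (f z = 0 <-> g z = 0)].
have aeok : {ae tau, forall z, ok z}.
  have h1 := density_ae_fin_num mu1 df; have h2 := density_ae_fin_num nu1 dg.
  have h3 := density_ae_eq0 munu df dg; have h4 := density_ae_eq0 numu dg df.
  by apply: filterS2 (filterI h1 h2) (filterI h3 h4) => z [? ?] [? ?]; split.
have ok_dom z : ok z -> f z = 0 /\ g z = 0 \/ z \in dr_domain f g.
  move=> [fz gz fg]; have [f00|fn0] := eqVneq (f z) 0.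
    by left; split => //; exact/fg.
  have gn0 : g z != 0 by apply/eqP => /fg/eqP; exact/negP.
  right; rewrite inE; split; first by rewrite lt0e fn0 f0 ltey_eq fz.
  by rewrite lt0e gn0 g0 ltey_eq gz.
apply: filterS2 (aeok) sec => z zok; apply: filterS2 (aeok) => z' z'ok /=.
have [[f00 g00]|zd] := ok_dom _ zok.
  by rewrite f00 g00 mul0e !mule0.
have [[f00 g00]|z'd] := ok_dom _ z'ok.
  by rewrite f00 g00 mul0e !mule0.
rewrite zd z'd/= lee_fin.
move: zd z'd; rewrite !inE => -[/andP[fz0 fzy] /andP[gz0 gzy]].
move=> [/andP[fz'0 fz'y] /andP[gz'0 gz'y]].
have [fz gz _] := zok; have [fz' gz' _] := z'ok.
have F0 : (0 < fine (f z))%R by rewrite fine_gt0// fz0.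
have G0 : (0 < fine (g z))%R by rewrite fine_gt0// gz0.
have F'0 : (0 < fine (f z'))%R by rewrite fine_gt0// fz'0.
have G'0 : (0 < fine (g z'))%R by rewrite fine_gt0// gz'0.
rewrite ler_ln ?posrE ?divr_gt0// -(fineK fz) -(fineK gz) -(fineK fz') -(fineK gz').
rewrite -!EFinM lee_fin ler_pdivrMr ?divr_gt0// ler_pdivrMr// => h.
rewrite -(ler_pM2r (x := (fine (g z'))^-1)) ?invr_gt0// mulfK ?gt_eqF//.
by apply: (le_trans h); rewrite le_eqVlt; apply/orP; left; apply/eqP; ring.
Qed.

Lemma d_DR_eq mu nu nu' :
  (forall A, measurable A -> nu A = nu' A) -> d_DR mu nu = d_DR mu nu'.
Proof.
move=> nunu'; rewrite /d_DR nunu'//.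
have ns : nu.-null_set = nu'.-null_set.
  by apply/seteqP; split=> N h A mA AN; [rewrite -nunu'|rewrite nunu']; rewrite ?h.
rewrite /null_dominates ns.
have densE tau g : has_density nu tau g = has_density nu' tau g.
  apply/propext; split=> -[mg g0 gE]; split => // A mA.
    by rewrite -nunu'// gE.
  by rewrite nunu'// gE.
suff -> : [set r | exists (tau : {sigma_finite_measure set Z -> \bar R})
      (f g : Z -> \bar R),
      [/\ has_density mu tau f, has_density nu tau g & r = dr_sup tau f g]] =
    [set r | exists (tau : {sigma_finite_measure set Z -> \bar R})
      (f g : Z -> \bar R),
      [/\ has_density mu tau f, has_density nu' tau g & r = dr_sup tau f g]] by [].
by apply/seteqP; split => r [tau [f [g [df]]]];
  [rewrite densE|rewrite -densE] => dg ->; exists tau, f, g.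
Qed.

(** The prior itself serves as dominating measure, with densities [1] and [g]. *)
Lemma d_DR_le (pi : probability Z R) nu (g : Z -> \bar R) (C : R) : (0 < C)%R ->
  nu [set: Z] = 1 -> (forall z, g z \is a fin_num) -> has_density nu pi g ->
  {ae pi \x pi, forall zz, g zz.2 <= C%:E * g zz.1} ->
  d_DR pi nu <= (ln C)%:E.
Proof.
move=> C0 nu1 gfin dg gC; have [mg g0 nuE] := dg.
have d1 : has_density pi pi (cst 1).
  split => // A mA; by rewrite integral_cst// mul1e.
have sec := ae_xsection gC.
have nupi : nu `<< pi.
  apply/null_content_dominatesP => A mA A0; rewrite nuE//.
  have := @integral_abs_eq0 _ _ _ pi A g mA (measurable_funTS mg) A0.
  by under eq_integral do rewrite gee0_abs//.
have pinu : pi `<< nu.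
  apply/null_content_dominatesP => A mA A0; apply/eqP.
  rewrite eq_le measure_ge0 andbT.
  have : pi A * nu setT <= C%:E * (pi setT * nu A).
    apply: (density_cross (ltW C0) d1 dg) => //.
    by apply: filterS sec => z; apply: filterS => z' /=; rewrite !mul1e.
  by rewrite nu1 mule1 A0 !mule0.
rewrite /d_DR.
have -> : `[< pi setT = 0 /\ nu setT = 0 >] = false.
  by apply/asboolPn; rewrite nu1 => -[_ /eqP]; rewrite onee_eq0.
rewrite (asboolT (conj pinu nupi)).
apply: ge_ereal_inf; exists (dr_sup pi (cst 1) g); first by exists pi, (cst 1), g.
apply/ess_supP; apply: filterS gC => -[z z'] /= gzz'.
case: ifPn => [/andP[zd z'd]|_]; last by rewrite leNye.
move: zd z'd; rewrite !inE => -[_ /andP[gz0 gzy]] [_ /andP[gz'0 gz'y]].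
have G0 : (0 < fine (g z))%R by rewrite fine_gt0// gz0.
have G'0 : (0 < fine (g z'))%R by rewrite fine_gt0// gz'0.
rewrite divr1 div1r invf_div lee_fin ler_ln ?posrE ?divr_gt0// ler_pdivrMr//.
by rewrite -lee_fin EFinM !fineK.
Qed.

End density_ratio.

(** * Kernels, disintegration and the law of the output at a level *)

Lemma ge0_integral_mrestr d (T : measurableType d) (R : realType)
    (mu : {measure set T -> \bar R}) (D : set T) (mD : measurable D)
    (f : T -> \bar R) : measurable_fun [set: T] f -> (forall x, 0 <= f x) ->
  \int[mrestr mu mD]_x f x = \int[mu]_(x in D) f x.
Proof.
move=> mf f0; rewrite (@ge0_negligible_integral _ _ _ (mrestr mu mD) _ (~` D))//; last 2 first.
- exact: measurableC.
- by rewrite [LHS](_ : _ = mu (~` D `&` D))// setICl measure0.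
rewrite setTD setCK; apply: eq_measure_integral => A mA AD.
by rewrite [LHS](_ : _ = mu (A `&` D))// (setIidl AD).
Qed.

Section pullback_kernel.
Context dY dX dT (Y : measurableType dY) (X : measurableType dX)
  (T : measurableType dT) (R : realType).
Variables (k : R.-pker X ~> T) (f : Y -> X).

(** The kernel [y |-> k (f y)]. *)
Definition kpullback (_ : measurable_fun [set: Y] f) (y : Y) :
  {measure set T -> \bar R} := k (f y).

Hypothesis mf : measurable_fun [set: Y] f.

Let measurable_kpullback U : measurable U ->
  measurable_fun [set: Y] (kpullback mf ^~ U).
Proof. by move=> mU; exact: measurableT_comp (measurable_kernel k U mU) mf. Qed.

HB.instance Definition _ :=
  isKernel.Build _ _ _ _ _ (kpullback mf) measurable_kpullback.

Let kpullback_setT y : kpullback mf y [set: T] = 1.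
Proof. exact: prob_kernel. Qed.

HB.instance Definition _ :=
  Kernel_isProbability.Build _ _ _ _ _ (kpullback mf) kpullback_setT.

End pullback_kernel.

Section constant_kernel.
Context dY (Y : measurableType dY) (R : realType).
Variable m : {measure set Y -> \bar R}.
Hypothesis m_lty : m [set: Y] < +oo.

(** The kernel from a point given by a finite measure. *)
Definition kconst (_ : m [set: Y] < +oo) (_ : unit) : {measure set Y -> \bar R} := m.

Let measurable_kconst U : measurable U ->
  measurable_fun [set: unit] (kconst m_lty ^~ U).
Proof. by move=> mU; exact: measurable_cst. Qed.

HB.instance Definition _ :=
  isKernel.Build _ _ _ _ _ (kconst m_lty) measurable_kconst.

Let kconst_uub : measure_fam_uub (kconst m_lty).
Proof.
exists (fine (m setT) + 1)%R => y; rewrite EFinD fineK ?ge0_fin_numE//.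
by rewrite lteDl ?lte01// ge0_fin_numE.
Qed.

HB.instance Definition _ :=
  Kernel_isFinite.Build _ _ _ _ _ (kconst m_lty) kconst_uub.

End constant_kernel.

(** A disintegration of the probabilities of events extends to nonnegative
    functions: on [Z @^-1` B], [mu] is the composite of the restriction of the
    law of [Z] to [B] with the kernel [k]. *)
Lemma ge0_integral_disintegration dX dZ (X : measurableType dX)
    (Zs : measurableType dZ) (R : realType) (mu : probability X R)
    (Z : {mfun X >-> Zs}) (k : R.-pker Zs ~> X) :
  (forall A B, measurable A -> measurable B ->
     mu (A `&` Z @^-1` B) = \int[distribution mu Z]_(z in B) k z A) ->
  forall (phi : X -> \bar R) B, measurable_fun [set: X] phi ->
    (forall x, 0 <= phi x) -> measurable B ->
    \int[mu]_(x in Z @^-1` B) phi x =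
      \int[distribution mu Z]_(z in B) \int[k z]_x phi x.
Proof.
move=> muk phi B mphi phi0 mB.
have mZB : measurable (Z @^-1` B) by rewrite -[_ @^-1` _]setTI; exact: measurable_funPT.
rewrite -(ge0_integral_mrestr mu mZB)//.
have lty : mrestr (distribution mu Z) mB [set: Zs] < +oo.
  by rewrite /mrestr setTI ltey_eq fin_num_measure.
pose l := kconst lty.
pose k' := kpullback k (@measurable_snd _ _ unit Zs).
transitivity (\int[kcomp l k' tt]_x phi x).
  apply: eq_measure_integral => A mA _.
  rewrite [LHS]muk// -(ge0_integral_mrestr (distribution mu Z) mB)//.
  exact: measurable_kernel.
rewrite integral_kcomp// -(ge0_integral_mrestr (distribution mu Z) mB)//.
  by apply: measurable_fun_integral_kernel => // U mU; exact: measurable_kernel.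
by move=> z; exact: integral_ge0.
Qed.

Section level_law.
Context (R : realType) (dX dT dZ : measure_display) (X : measurableType dX)
  (T : measurableType dT) (Zs : measurableType dZ).
Variables (M : mechanism R X T) (k : R.-pker Zs ~> X).

(** [k z], as a probability. *)
Definition kernel_law (z : Zs) : set X -> \bar R := k z.

HB.instance Definition _ z := Measure.on (kernel_law z).

Let kernel_law_setT z : kernel_law z [set: X] = 1.
Proof. exact: prob_kernel. Qed.

HB.instance Definition _ z :=
  Measure_isProbability.Build _ _ _ (kernel_law z) (kernel_law_setT z).

(** The output law of [M] when [X] has law [k z]. *)
Definition level_law (z : Zs) : {measure set T -> \bar R} :=
  output_law M (kernel_law z).

Let measurable_level_law B : measurable B ->
  measurable_fun [set: Zs] (level_law ^~ B).
Proof.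
move=> mB; rewrite /level_law/= /output_law.
apply: measurable_fun_integral_kernel => //.
- by move=> U mU; exact: measurable_kernel.
- exact: measurable_release_law.
Qed.

HB.instance Definition _ :=
  isKernel.Build _ _ _ _ _ level_law measurable_level_law.

Let level_law_setT z : level_law z [set: T] = 1.
Proof. exact: probability_setT. Qed.

HB.instance Definition _ :=
  Kernel_isProbability.Build _ _ _ _ _ level_law level_law_setT.

End level_law.

Lemma eq_output_law (R : realType) (dX dT : measure_display)
    (X : measurableType dX) (T : measurableType dT) (M : mechanism R X T)
    (mu nu : probability X R) :
  (forall A, measurable A -> mu A = nu A) -> output_law M mu = output_law M nu.
Proof.
by move=> mn; apply/funext => B; apply: eq_measure_integral => A mA _; exact: mn.
Qed.

(** * Joint laws and their densities *)

Section joint_law.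
Context (R : realType) (dZ dT : measure_display) (Zs : measurableType dZ)
  (T : measurableType dT).
Variables (pi : probability Zs R) (L : R.-pker Zs ~> T).

(** The law of [(Z, T)] when [Z] has law [pi] and [T] has law [L z] given
    [Z = z]. *)
Definition joint_law (F : set (Zs * T)) : \bar R := \int[pi]_z L z (xsection F z).

Lemma measurable_kernel_xsection (F : set (Zs * T)) : measurable F ->
  measurable_fun [set: Zs] (fun z => L z (xsection F z)).
Proof. by move=> mF; apply: measurable_fun_xsection_finite_kernel; rewrite inE. Qed.

Let joint_law0 : joint_law set0 = 0.
Proof. by apply: integral0_eq => z _; rewrite xsection0 measure0. Qed.

Let joint_law_ge0 F : 0 <= joint_law F.
Proof. exact: integral_ge0. Qed.

Let joint_law_sigma_additive : semi_sigma_additive joint_law.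
Proof.
move=> F mF tF mUF.
rewrite [X in _ --> X](_ : _ = \sum_(0 <= n <oo) joint_law (F n)); last first.
  rewrite /joint_law -integral_nneseries//; last first.
    by move=> n; exact: measurable_kernel_xsection.
  apply: eq_integral => z _; apply/esym/cvg_lim => //.
  rewrite xsection_bigcup; apply: measure_sigma_additive.
    by move=> i; exact: measurable_xsection.
  exact: trivIset_xsection.
exact: is_cvg_nneseries.
Qed.

HB.instance Definition _ := isMeasure.Build _ _ _ joint_law
  joint_law0 joint_law_ge0 joint_law_sigma_additive.

Let joint_law_setT : joint_law setT = 1.
Proof.
rewrite /joint_law; under eq_integral do rewrite xsectionE preimage_setT prob_kernel.
by rewrite integral_cst// mul1e; exact: probability_setT.
Qed.

HB.instance Definition _ := Measure_isProbability.Build _ _ _ joint_law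
  joint_law_setT.

Lemma joint_lawX A B : measurable A -> measurable B ->
  joint_law (A `*` B) = \int[pi]_(z in A) L z B.
Proof.
move=> mA mB; rewrite /joint_law [RHS]integral_mkcond.
apply: eq_integral => z _; rewrite patchE; case: ifPn => zA.
  by rewrite in_xsectionX.
by rewrite notin_xsectionX// measure0.
Qed.

End joint_law.

Section joint_density.
Context (R : realType) (dZ dT : measure_display) (Zs : measurableType dZ)
  (T : measurableType dT).
Variables (pi : probability Zs R) (L : R.-pker Zs ~> T) (pT : probability T R).
Variable h : Zs * T -> \bar R.
Hypotheses (mh : measurable_fun [set: Zs * T] h) (h0 : forall zt, 0 <= h zt).
Hypothesis hE : forall F, measurable F ->
  joint_law pi L F = \int[pi \x pT]_(zt in F) h zt.

Lemma integral_joint_density A B : measurable A -> measurable B ->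
  \int[pT]_(t in B) \int[pi]_(z in A) h (z, t) = \int[pi]_(z in A) L z B.
Proof.
move=> mA mB; rewrite -joint_lawX// hE; last exact: measurableX.
rewrite [RHS]integral_mkcond (fubini_tonelli2 (h \_ (A `*` B))); last 2 first.
- by apply/(measurable_restrictT _ (measurableX mA mB)); exact: measurable_funTS.
- by move=> zt; rewrite patchE; case: ifPn.
rewrite [LHS]integral_mkcond; apply: eq_integral => t _.
rewrite patchE /fubini_G; case: ifPn => tB.
  rewrite [LHS]integral_mkcond. apply: eq_integral => z _; rewrite !patchE in_setX/= tB andbT.
  by case: ifPn.
by rewrite integral0_eq// => z _; rewrite patchE in_setX/= (negbTE tB) andbF.
Qed.

(* [rho] stands for [pi \x pi]; all that is used of it is Tonelli's theorem. *)
Variable rho : probability (Zs * Zs)%type R.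
Hypothesis rhoE : forall f : Zs * Zs -> \bar R,
  measurable_fun [set: Zs * Zs] f -> (forall w, 0 <= f w) ->
  \int[rho]_w f w = \int[pi]_z \int[pi]_z' f (z, z') /\
  \int[rho]_w f w = \int[pi]_z' \int[pi]_z f (z, z').

(** A density [h (z, t)] of the joint law is also a density of the law of a pair
    of levels [(z, z')] and an output drawn at the level [z]. *)
Lemma joint_density_fst E : measurable E ->
  \int[rho]_w L w.1 (xsection E w) =
  \int[rho \x pT]_(w in E) h (w.1.1, w.2).
Proof.
move=> mE; rewrite [RHS]integral_mkcond; set f := (_ \_ E).
have f0 w : 0 <= f w by rewrite /f patchE; case: ifPn.
have mf : measurable_fun setT f.
  apply/(measurable_restrictT _ mE); apply: measurable_funTS.
  apply: (measurableT_comp mh); apply/measurable_fun_pairP; split => /=.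
    exact: measurableT_comp measurable_fst measurable_fst.
  exact: measurable_snd.
rewrite (fubini_tonelli1 f)//.
have mF : measurable_fun setT (fubini_F pT f).
  exact: measurable_fun_fubini_tonelli_F.
rewrite (rhoE mF (fun=> integral_ge0 _ _)).2//.
have mL : measurable_fun setT (fun w => L w.1 (xsection E w)).
  exact: (measurable_kernel_xsection (kpullback L measurable_fst)).
rewrite (rhoE mL (fun=> measure_ge0 _ _)).2.
apply: eq_integral => z' _.
pose E' := [set zt : Zs * T | E ((zt.1, z'), zt.2)].
have mE' : measurable E'.
  rewrite (_ : E' = (fun zt => ((zt.1, z'), zt.2)) @^-1` E)//.
  rewrite -[_ @^-1` _]setTI; have : measurable_fun [set: Zs * T]
      (fun zt => ((zt.1, z'), zt.2)); last by apply.
  by apply: measurable_fun_pair => //; exact: measurable_fun_pair.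
have -> : \int[pi]_z L z (xsection E (z, z')) = joint_law pi L E'.
  apply: eq_integral => z _; congr (L z _).
rewrite hE// integral_mkcond (fubini_tonelli1 (h \_ E')); last 2 first.
- by apply/(measurable_restrictT _ mE'); exact: measurable_funTS.
- by move=> zt; rewrite patchE; case: ifPn.
apply: eq_integral => z _; rewrite /fubini_F; apply: eq_integral => t _.
by rewrite /f !patchE; congr (if _ then _ else _); apply/idP/idP; rewrite !inE.
Qed.

(** The same, with the output drawn at the second level. *)
Lemma joint_density_snd E : measurable E ->
  \int[rho]_w L w.2 (xsection E w) =
  \int[rho \x pT]_(w in E) h (w.1.2, w.2).
Proof.
move=> mE; rewrite [RHS]integral_mkcond; set f := (_ \_ E).
have f0 w : 0 <= f w by rewrite /f patchE; case: ifPn.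
have mf : measurable_fun setT f.
  apply/(measurable_restrictT _ mE); apply: measurable_funTS.
  apply: (measurableT_comp mh); apply/measurable_fun_pairP; split => /=.
    exact: measurableT_comp measurable_snd measurable_fst.
  exact: measurable_snd.
rewrite (fubini_tonelli1 f)//.
have mF : measurable_fun setT (fubini_F pT f).
  exact: measurable_fun_fubini_tonelli_F.
rewrite (rhoE mF (fun=> integral_ge0 _ _)).1//.
have mL : measurable_fun setT (fun w => L w.2 (xsection E w)).
  exact: (measurable_kernel_xsection (kpullback L measurable_snd)).
rewrite (rhoE mL (fun=> measure_ge0 _ _)).1.
apply: eq_integral => z _.
pose E' := [set zt : Zs * T | E ((z, zt.1), zt.2)].
have mE' : measurable E'.
  rewrite (_ : E' = (fun zt => ((z, zt.1), zt.2)) @^-1` E)//.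
  rewrite -[_ @^-1` _]setTI; have : measurable_fun [set: Zs * T]
      (fun zt => ((z, zt.1), zt.2)); last by apply.
  by apply: measurable_fun_pair => //; exact: measurable_fun_pair.
have -> : \int[pi]_z' L z' (xsection E (z, z')) = joint_law pi L E'.
  apply: eq_integral => z' _; congr (L z' _).
rewrite hE// integral_mkcond (fubini_tonelli1 (h \_ E')); last 2 first.
- by apply/(measurable_restrictT _ mE'); exact: measurable_funTS.
- by move=> zt; rewrite patchE; case: ifPn.
apply: eq_integral => z' _; rewrite /fubini_F; apply: eq_integral => t _.
by rewrite /f !patchE; congr (if _ then _ else _); apply/idP/idP; rewrite !inE.
Qed.

End joint_density.

(** * Sets of full outer measure and kernels given by a density *)

Section thick.
Context (R : realType).

(** [W], which need not be measurable, has full outer measure. *)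
Definition thick d (Z : measurableType d) (pi : probability Z R) (W : set Z) :=
  forall A, measurable A -> W `<=` A -> pi A = 1.

Lemma thick_ae d (Z : measurableType d) (pi : probability Z R) (W A : set Z) :
  thick pi W -> measurable A -> W `<=` A -> {ae pi, forall z, A z}.
Proof.
move=> tW mA WA; exists (~` A); split => //; first exact: measurableC.
by rewrite probability_setC// (tW A)// subee.
Qed.

Lemma thick_ae_le d (Z : measurableType d) (pi : probability Z R) (W : set Z)
    (f g : Z -> \bar R) : thick pi W -> measurable_fun [set: Z] f ->
  measurable_fun [set: Z] g -> (forall z, W z -> f z <= g z) ->
  {ae pi, forall z, f z <= g z}.
Proof.
move=> tW mf mg fg; apply: (thick_ae tW) => //.
by rewrite -[X in measurable X]setTI; exact: measurable_lee.
Qed.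

Lemma thick_product d d' (Z : measurableType d) (Z' : measurableType d')
    (pi : probability Z R) (pi' : probability Z' R) (W : set Z) (W' : set Z') :
  thick pi W -> thick pi' W' -> thick (pi \x pi')%E (W `*` W').
Proof.
move=> tW tW' A mA WA; rewrite -[LHS]/(\int[pi]_z pi' (xsection A z)).
have mpi : measurable_fun setT (fun z => pi' (xsection A z)).
  exact: measurable_fun_xsection.
rewrite (@ge0_ae_eq_integral _ _ _ pi _ _ (cst 1))//.
  by rewrite integral_cst// mul1e; exact: probability_setT.
have : {ae pi, forall z, (cst 1 z <= pi' (xsection A z) :> \bar R)}.
  apply: (thick_ae_le tW) => // z Wz; rewrite /cst tW'//.
    exact: measurable_xsection.
  by move=> z' Wz'; rewrite /xsection/= inE; exact: WA.
apply: filterS => z h _; apply/eqP; rewrite eq_le h andbT.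
by rewrite probability_le1//; exact: measurable_xsection.
Qed.

End thick.

Section density_kernel.
Context (R : realType) (dZ dT : measure_display) (Zs : measurableType dZ)
  (T : measurableType dT) (pi : probability Zs R) (g : Zs * T -> \bar R).

(** [g] is, for each [t], a probability density with respect to [pi]. *)
Definition kernel_density := [/\ measurable_fun [set: Zs * T] g,
  forall zt, 0 <= g zt & forall t, \int[pi]_z g (z, t) = 1].

(** The kernel from [T] to [Zs] with density [g] with respect to [pi]. *)
Definition density_kernel (_ : kernel_density) (t : T) (A : set Zs) : \bar R :=
  \int[pi]_(z in A) g (z, t).

Hypothesis hg : kernel_density.

Let mg t : measurable_fun [set: Zs] (fun z => g (z, t)).
Proof. have [mg _ _] := hg; exact: measurableT_comp. Qed.

Let density_kernel0 t : density_kernel hg t set0 = 0.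
Proof. exact: integral_set0. Qed.

Let density_kernel_ge0 t A : 0 <= density_kernel hg t A.
Proof. have [_ g0 _] := hg; exact: integral_ge0. Qed.

Let density_kernel_sigma_additive t : semi_sigma_additive (density_kernel hg t).
Proof. have [_ g0 _] := hg; exact: semi_sigma_additive_nng_induced. Qed.

HB.instance Definition _ t := isMeasure.Build _ _ _ (density_kernel hg t)
  (density_kernel0 t) (density_kernel_ge0 t) (@density_kernel_sigma_additive t).

(** [density_kernel], with values in the measures. *)
Definition mdensity_kernel : T -> {measure set Zs -> \bar R} :=
  density_kernel hg.

Let measurable_density_kernel A : measurable A ->
  measurable_fun [set: T] (mdensity_kernel ^~ A).
Proof.
move=> mA; have [mg' g0 _] := hg.
have mAT : measurable (A `*` [set: T]) by exact: measurableX.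
rewrite (_ : mdensity_kernel ^~ A = fubini_G pi (g \_ (A `*` [set: T]))).
  apply: measurable_fun_fubini_tonelli_G.
    by apply/(measurable_restrictT _ mAT); exact: measurable_funTS.
  by move=> zt; rewrite patchE; case: ifPn.
apply/funext => t; rewrite /fubini_G.
rewrite [LHS]integral_mkcond; apply: eq_integral => z _.
by rewrite !patchE in_setX in_setT andbT.
Qed.

HB.instance Definition _ :=
  isKernel.Build _ _ _ _ _ mdensity_kernel measurable_density_kernel.

Let density_kernel_setT t : mdensity_kernel t [set: Zs] = 1.
Proof. have [_ _ g1] := hg; exact: g1. Qed.

HB.instance Definition _ :=
  Kernel_isProbability.Build _ _ _ _ _ mdensity_kernel density_kernel_setT.

End density_kernel.

(** * A posterior whose density ratio is bounded *)

Section posterior_version.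
Context (R : realType) (dZ dT : measure_display) (Zs : measurableType dZ)
  (T : measurableType dT).
Variables (pi : probability Zs R) (L : R.-pker Zs ~> T) (pT : probability T R).
Hypothesis pTE : forall B, measurable B -> pT B = \int[pi]_z L z B.
Variables (C : R) (W : set Zs).
Hypotheses (C0 : (0 < C)%R) (tW : thick pi W).
Hypothesis LC : forall z z', W z -> W z' -> forall B, measurable B ->
  L z B <= C%:E * L z' B.

Lemma level_le_mixture z B : W z -> measurable B -> L z B <= C%:E * pT B.
Proof.
move=> Wz mB; have mL := measurable_kernel L B mB.
rewrite pTE// -ge0_integralZl//; last by rewrite lee_fin ltW.
have -> : L z B = \int[pi]_(z' in setT) cst (L z B) z'.
  by rewrite integral_cst// [X in _ * X]probability_setT mule1.
apply: ae_ge0_le_integral => //.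
- by move=> z' _; rewrite mule_ge0// lee_fin ltW.
- exact: measurable_funeM.
suff : {ae pi, forall z', cst (L z B) z' <= C%:E * L z' B}.
  by apply: filterS => z' h _.
apply: (thick_ae_le tW) => //; first exact: measurable_funeM.
by move=> z' Wz'; exact: LC.
Qed.

(** [L z (xsection F z)] vanishes with [pT (xsection F z)] at every level of
    [W], hence at almost every level. *)
Lemma joint_law_dominated : joint_law pi L `<< (pi \x pT).
Proof.
apply/null_content_dominatesP => F mF F0; apply/eqP.
rewrite eq_le measure_ge0 andbT.
have mp : measurable_fun setT (fun z => pT (xsection F z)).
  exact: measurable_fun_xsection.
have <- : C%:E * \int[pi]_z pT (xsection F z) = 0.
  by rewrite -[X in _ * X]/((pi \x pT) F) F0 mule0.
rewrite -ge0_integralZl//; last by rewrite lee_fin ltW.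
apply: ae_ge0_le_integral => //.
- exact: measurable_kernel_xsection.
- by move=> z' _; rewrite mule_ge0// lee_fin ltW.
- exact: measurable_funeM.
suff : {ae pi, forall z, L z (xsection F z) <= C%:E * pT (xsection F z)}.
  by apply: filterS => z h _.
apply: (thick_ae_le tW).
- exact: measurable_kernel_xsection.
- exact: measurable_funeM.
- by move=> z Wz; apply: level_le_mixture => //; exact: measurable_xsection.
Qed.

Lemma joint_density_exists : exists h : Zs * T -> \bar R,
  [/\ measurable_fun [set: Zs * T] h, forall zt, 0 <= h zt,
      forall zt, h zt \is a fin_num
    & forall F, measurable F ->
        joint_law pi L F = \int[pi \x pT]_(zt in F) h zt].
Proof.
pose m : probability (Zs * T)%type R := (pi \x pT)%E.
pose j : probability (Zs * T)%type R := joint_law pi L.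
have [h [h0 hfin hi hE]] := @radon_nikodym_sigma_finite _ _ R m j joint_law_dominated.
by exists h; split => //; exact: measurable_int hi.
Qed.

Lemma pi_productE (f : Zs * Zs -> \bar R) :
  measurable_fun [set: Zs * Zs] f -> (forall w, 0 <= f w) ->
  \int[pi \x pi]_w f w = \int[pi]_z \int[pi]_z' f (z, z') /\
  \int[pi \x pi]_w f w = \int[pi]_z' \int[pi]_z f (z, z').
Proof. by move=> mf f0; rewrite -fubini_tonelli// -fubini_tonelli1. Qed.


(** Let [E] be the set of the [((z, z'), t)] at which the bound fails. The law of
    [(z, z')] and of an output drawn at the level [z'] gives [E] at most [C]
    times the mass that it has when the output is drawn at the level [z]; the
    densities of these two laws satisfy the opposite strict inequality on
    [E], so [E] is negligible. *)
Lemma joint_density_ratio (h : Zs * T -> \bar R) :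
  measurable_fun [set: Zs * T] h -> (forall zt, 0 <= h zt) ->
  (forall zt, h zt \is a fin_num) ->
  (forall F, measurable F -> joint_law pi L F = \int[pi \x pT]_(zt in F) h zt) ->
  {ae pT, forall t, {ae pi \x pi, forall w, h (w.2, t) <= C%:E * h (w.1, t)}}.
Proof.
move=> mh h0 hfin hE.
pose rho : probability (Zs * Zs)%type R := (pi \x pi)%E.
have rhoE f : measurable_fun [set: Zs * Zs] f -> (forall w, 0 <= f w) ->
    \int[rho]_w f w = \int[pi]_z \int[pi]_z' f (z, z') /\
    \int[rho]_w f w = \int[pi]_z' \int[pi]_z f (z, z') by exact: pi_productE.
(* Below, Tonelli's theorem is all that is used of [rho]. *)
suff : {ae pT, forall t, {ae rho, forall w, h (w.2, t) <= C%:E * h (w.1, t)}} by [].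
have trho : thick rho (W `*` W) by exact: thick_product.
have mh1 : measurable_fun [set: (Zs * Zs) * T] (fun w => h (w.1.1, w.2)).
  apply: (measurableT_comp mh); apply: measurable_fun_pair => //.
  exact: measurableT_comp measurable_fst measurable_fst.
have mh2 : measurable_fun [set: (Zs * Zs) * T] (fun w => h (w.1.2, w.2)).
  apply: (measurableT_comp mh); apply: measurable_fun_pair => //.
  exact: measurableT_comp measurable_snd measurable_fst.
have fstE := @joint_density_fst _ _ _ _ _ pi L pT h mh h0 hE rho rhoE.
have sndE := @joint_density_snd _ _ _ _ _ pi L pT h mh h0 hE rho rhoE.
clearbody rho.
have i1 : (rho \x pT).-integrable [set: (Zs * Zs) * T] (fun w => h (w.1.1, w.2)).
  apply/integrableP; split => //; under eq_integral do rewrite gee0_abs//.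
  rewrite -fstE//.
  under eq_integral do rewrite xsectionE preimage_setT prob_kernel.
  by rewrite integral_cst// mul1e [X in X < _]probability_setT ltry.
have i2 : (rho \x pT).-integrable [set: (Zs * Zs) * T] (fun w => h (w.1.2, w.2)).
  apply/integrableP; split => //; under eq_integral do rewrite gee0_abs//.
  rewrite -sndE//.
  under eq_integral do rewrite xsectionE preimage_setT prob_kernel.
  by rewrite integral_cst// mul1e [X in X < _]probability_setT ltry.
pose E := [set w : (Zs * Zs) * T | C%:E * h (w.1.1, w.2) < h (w.1.2, w.2)].
have mE : measurable E.
  rewrite -[E]setTI; apply: measurable_lte => //; exact: measurable_funeM.
have E0 : (rho \x pT) E = 0.
  apply: (@measure0_lt_integral _ _ _ (rho \x pT) E (fun w => h (w.1.2, w.2))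
    (fun w => C%:E * h (w.1.1, w.2))) => //.
  - exact: integrableS i2.
  - by apply: integrableZl => //; exact: integrableS i1.
  - by move=> w _; rewrite fin_numM.
  rewrite -sndE// ge0_integralZl//; last 2 first.
  - exact: measurable_funTS.
  - by rewrite lee_fin ltW.
  rewrite -fstE// -ge0_integralZl//; last 2 first.
  - exact: (measurable_kernel_xsection (kpullback L measurable_fst)).
  - by rewrite lee_fin ltW.
  apply: ae_ge0_le_integral => //.
  - exact: (measurable_kernel_xsection (kpullback L measurable_snd)).
  - by move=> w _; rewrite mule_ge0// lee_fin ltW.
  - apply: measurable_funeM.
    exact: (measurable_kernel_xsection (kpullback L measurable_fst)).
  suff : {ae rho, forall w,
      L w.2 (xsection E w) <= C%:E * L w.1 (xsection E w)}.
    by apply: filterS => w h' _.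
  apply: (thick_ae_le trho).
  - exact: (measurable_kernel_xsection (kpullback L measurable_snd)).
  - apply: measurable_funeM.
    exact: (measurable_kernel_xsection (kpullback L measurable_fst)).
  - by move=> w [W1 W2]; apply: LC => //; exact: measurable_xsection.
apply: filterS (ae_ysection0 mE E0) => t Et0.
have := ae_notin (measurable_ysection t mE) Et0.
apply: filterS => w; rewrite leNgt => Ew; apply/negP => h'; apply: Ew.
by rewrite /ysection/= inE.
Qed.

(** There is a version of the posterior of [Z] given [T] whose density with
    respect to the prior varies by a factor of at most [C]. *)
Theorem posterior_version : exists Q : R.-pker T ~> Zs,
  (forall A B, measurable A -> measurable B ->
     \int[pT]_(t in B) Q t A = \int[pi]_(z in A) L z B) /\
  {ae pT, forall t, d_DR pi (Q t) <= (ln C)%:E}.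
Proof.
have [h [mh h0 hfin hE]] := joint_density_exists.
have mass : {ae pT, forall t, \int[pi]_z h (z, t) = 1}.
  have mG : measurable_fun [set: T] (fun t => \int[pi]_z h (z, t)).
    exact: measurable_fun_fubini_tonelli_G.
  have : ae_eq pT setT (cst 1) (fun t => \int[pi]_z h (z, t)).
    apply: integral_ae_eq => //.
      exact: finite_measure_integrable_cst.
    move=> B _ mB; rewrite (integral_joint_density mh h0 hE)// -pTE//.
    by rewrite integral_cst// mul1e.
  by apply: filterS => t /(_ I).
(* On the null set of outputs where [h] is not a probability density in [z],
   the posterior is set to the prior. *)
pose ok t := \int[pi]_z h (z, t) == 1.
pose g zt := if ok zt.2 then h zt else 1.
have mok : measurable_fun [set: T] ok.
  apply: (measurable_fun_bool true).
  rewrite setTI (_ : _ @^-1` _ = [set t | \int[pi]_z h (z, t) = 1]); last first.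
    by apply/seteqP; split => t /eqP.
  rewrite -[X in measurable X]setTI; apply: measurable_eqe => //.
  exact: measurable_fun_fubini_tonelli_G.
have mg : measurable_fun [set: Zs * T] g.
  apply: measurable_fun_if => //; first exact: measurableT_comp.
  exact: measurable_funTS.
have g0 zt : 0 <= g zt by rewrite /g; case: ifP.
have gfin zt : g zt \is a fin_num by rewrite /g; case: ifP.
have g1 t : \int[pi]_z g (z, t) = 1.
  rewrite /g/=; have [/eqP//|_] := boolP (ok t).
  by rewrite integral_cst// mul1e [LHS]probability_setT.
have hg : kernel_density pi g by split.
exists (mdensity_kernel hg); split => [A B mA mB|].
  rewrite -(integral_joint_density mh h0 hE)//.
  apply: ge0_ae_eq_integral => //.
  - exact/measurable_funTS/(measurable_kernel (mdensity_kernel hg)).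
  - pose hA zt := if zt.1 \in A then h zt else 0.
    have mhA : measurable_fun [set: Zs * T] hA.
      apply: measurable_fun_if => //.
        apply: (measurable_fun_bool true).
        rewrite setTI (_ : _ @^-1` _ = A `*` [set: T]); first exact: measurableX.
        apply/seteqP; split => [zt /= /set_mem ztA|zt /= [ztA _]] //.
        exact: mem_set.
      exact: measurable_funTS.
    have hA0 zt : 0 <= hA zt by rewrite /hA; case: ifP.
    have := measurable_fun_fubini_tonelli_G (m1 := pi) hA mhA hA0.
    rewrite (_ : fubini_G pi hA = (fun t => \int[pi]_(z in A) h (z, t))).
      exact: measurable_funTS.
    by apply/funext => t; rewrite [RHS]integral_mkcond; apply: eq_integral => z _.
  - by move=> t _; exact: integral_ge0.
  apply: filterS mass => t t1 _; apply: eq_integral => z _.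
  by rewrite /g /ok/= t1 eqxx.
apply: filterS2 mass (joint_density_ratio mh h0 hfin hE) => t t1 ht.
apply: (@d_DR_le _ _ _ pi _ (fun z => g (z, t))) => //.
- exact: (prob_kernel (s := mdensity_kernel hg)).
- by split => //; exact: measurableT_comp.
- by apply: filterS ht => w; rewrite /g /ok/= t1 eqxx.
Qed.

End posterior_version.

(** * Output laws of the conditionals and of the levels *)

Lemma sigma_finite_pker d d' (X : measurableType d) (Y : measurableType d')
  (R : realType) (k : R.-pker X ~> Y) x : sigma_finite [set: Y] (k x).
Proof.
exists (fun=> setT); first by rewrite bigcup_const.
by move=> _; split; rewrite ?prob_kernel ?ltry.
Qed.

Section levels.
Context (R : realType) (dX dT dZ : measure_display) (X : measurableType dX)
  (T : measurableType dT) (Zs : measurableType dZ) (Theta : Type).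
Variables (P : Theta -> probability X R) (c : conditioning X Theta)
  (Z : {mfun X >-> Zs}) (M : mechanism R X T) (theta : Theta)
  (k : R.-pker Zs ~> X).
Hypothesis kE : forall A B, measurable A -> measurable B ->
  P theta (A `&` Z @^-1` B) = \int[distribution (P theta) Z]_(z in B) k z A.
Hypothesis ck : forall x theta', c theta (fibre Z (Z x)) = Some theta' ->
  forall A, measurable A -> P theta' A = k (Z x) A.

Local Notation pi := (distribution (P theta) Z).
Local Notation L := (level_law M k).

Lemma measurable_preimage_mfun (A : set Zs) :
  measurable A -> measurable (Z @^-1` A).
Proof. by move=> mA; rewrite -[_ @^-1` _]setTI; exact: measurable_funPT. Qed.

Lemma integral_release_law A B : measurable A -> measurable B ->
  \int[P theta]_(x in Z @^-1` A) release_law M x B = \int[pi]_(z in A) L z B.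
Proof.
move=> mA mB; rewrite (ge0_integral_disintegration kE)//.
exact: measurable_release_law.
Qed.

Lemma output_law_mixture B : measurable B ->
  output_law M (P theta) B = \int[pi]_z L z B.
Proof. by move=> mB; rewrite -integral_release_law// preimage_setT. Qed.

Lemma output_law_level x theta' : c theta (fibre Z (Z x)) = Some theta' ->
  forall B, output_law M (P theta') B = L (Z x) B.
Proof.
move=> cx B; apply: (congr1 (@^~ B)).
exact: (@eq_output_law _ _ _ _ _ M (P theta') (kernel_law k (Z x)) (ck cx)).
Qed.

(** The levels of [Z] at which the conditional law is defined. *)
Definition defined_levels : set Zs :=
  [set z | exists2 x, Z x = z & c theta (fibre Z z) <> None].

(** The set of these levels need not be measurable, nor the range of [Z], which
    is why only its outer measure is considered. *)
Lemma thick_defined_levels :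
  {ae P theta, forall x, c theta (fibre Z (Z x)) <> None} ->
  thick pi defined_levels.
Proof.
move=> [N [mN N0 cN]] A mA WA; have mZA := measurable_preimage_mfun mA.
rewrite -[LHS]/(P theta (Z @^-1` A)).
have : P theta (~` (Z @^-1` A)) = 0.
  apply: (subset_measure0 _ mN _ N0); first exact: measurableC.
  by move=> x /= ZxA; apply: cN => /= cx; apply: ZxA; apply: WA; exists x.
rewrite probability_setC// => /eqP.
by rewrite sube_eq ?fin_num_adde_defl ?fin_num_measure// add0e eq_sym => /eqP.
Qed.

(** [unexceptional], at a single output event and a single bound. *)
Definition unexceptional_at (theta' : Theta) (B : set T) (a : \bar R) : Prop :=
  ({ae P theta, forall x, forall theta'',
      c theta (fibre Z (Z x)) = Some theta'' ->
      output_law M (P theta'') B <= a} -> output_law M (P theta') B <= a) /\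
  ({ae P theta, forall x, forall theta'',
      c theta (fibre Z (Z x)) = Some theta'' ->
      a <= output_law M (P theta'') B} -> a <= output_law M (P theta') B).

(** For a single event and a single bound, almost every conditional is
    unexceptional: either almost all levels satisfy the bound, or nothing is
    required. *)
Lemma ae_unexceptional_at B a : {ae P theta, forall x, forall theta',
  c theta (fibre Z (Z x)) = Some theta' -> unexceptional_at theta' B a}.
Proof.
have [le|nle] := pselect {ae P theta, forall x, forall theta'',
    c theta (fibre Z (Z x)) = Some theta'' -> output_law M (P theta'') B <= a};
  have [ge|nge] := pselect {ae P theta, forall x, forall theta'',
    c theta (fibre Z (Z x)) = Some theta'' -> a <= output_law M (P theta'') B}.
- by apply: filterS2 le ge => x lex gex th' cx; split=> _; [exact: lex|exact: gex].
- by apply: filterS le => x lex th' cx; split=> // _; exact: lex.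
- by apply: filterS ge => x gex th' cx; split=> // _; exact: gex.
- by apply: aeW => x th' cx; split.
Qed.

(** A level of positive probability meets every almost sure set. *)
Lemma positive_unexceptional z theta' : measurable (fibre Z z) ->
  c theta (fibre Z z) = Some theta' -> 0 < P theta (fibre Z z) ->
  unexceptional P c Z M theta theta'.
Proof.
move=> mE cE PE.
have meets (Q : X -> Prop) : {ae P theta, forall x, Q x} ->
    exists2 x, Z x = z & Q x.
  move=> [N [mN N0 QN]]; apply: contrapT => noQ.
  suff : P theta (fibre Z z) = 0 by move=> P0; rewrite P0 ltxx in PE.
  apply: (subset_measure0 mE mN _ N0) => x Zx; apply: QN => /= Qx.
  by apply: noQ; exists x.
move=> B a mB; split=> /meets[x Zx]; rewrite Zx => /(_ _ cE); exact.
Qed.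

(** The comparison of the masses that the posterior and the prior give to two
    sets of levels bounds the ratio of the essential supremum to the essential
    infimum, over the levels, of the probability of each output event. *)
Lemma unexceptional_output_law_le (C : R) (theta1 theta2 : Theta) (B : set T) :
  (0 < C)%R -> measurable B ->
  (forall A A', measurable A -> measurable A' ->
     pi A * \int[pi]_(z in A') L z B <= C%:E * (pi A' * \int[pi]_(z in A) L z B)) ->
  (forall q : rat, unexceptional_at theta1 B (ratr q)%:E) ->
  (forall q : rat, unexceptional_at theta2 B (ratr q)%:E) ->
  output_law M (P theta1) B <= C%:E * output_law M (P theta2) B.
Proof.
move=> C0 mB cross u1 u2.
have f1 : output_law M (P theta1) B \is a fin_num by exact: fin_num_measure.
have f2 : output_law M (P theta2) B \is a fin_num by exact: fin_num_measure.
(* Otherwise [q1] and [q2] with [C q2 < q1] separate the two probabilities; as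
   neither conditional is exceptional, levels [A'] with probability of [B]
   above [q1] and levels [A] with probability of [B] below [q2] have positive
   mass, against the hypothesis on [A] and [A']. *)
rewrite leNgt; apply/negP; rewrite -(fineK f1) -(fineK f2) -EFinM lte_fin.
move=> /rat_in_itvoo[q1]; rewrite in_itv/= => /andP[lt21 lt11].
have : (fine (output_law M (P theta2) B) < ratr q1 / C)%R.
  by rewrite ltr_pdivlMr// mulrC.
move=> /rat_in_itvoo[q2]; rewrite in_itv/= => /andP[lt22 ltqq].
have mL : measurable_fun setT (L ^~ B) by exact: measurable_kernel.
pose A' := [set z | (ratr q1)%:E < L z B].
pose A := [set z | L z B < (ratr q2)%:E].
have mA' : measurable A'.
  by rewrite -[A']setTI; exact: emeasurable_fun_o_infty.
have mA : measurable A.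
  by rewrite -[A]setTI; exact: emeasurable_fun_infty_o.
have A'0 : pi A' != 0.
  apply/eqP => A'0.
  have /(u1 q1).1 : {ae P theta, forall x, forall theta'',
      c theta (fibre Z (Z x)) = Some theta'' ->
      output_law M (P theta'') B <= (ratr q1)%:E}.
    apply: filterS (ae_notin (measurable_preimage_mfun mA') A'0).
    by move=> x A'x th'' cx; rewrite (output_law_level cx) leNgt; exact/negP.
  by rewrite -(fineK f1) lee_fin leNgt lt11.
have A0 : pi A != 0.
  apply/eqP => A0.
  have /(u2 q2).2 : {ae P theta, forall x, forall theta'',
      c theta (fibre Z (Z x)) = Some theta'' ->
      (ratr q2)%:E <= output_law M (P theta'') B}.
    apply: filterS (ae_notin (measurable_preimage_mfun mA) A0).
    by move=> x Ax th'' cx; rewrite (output_law_level cx) leNgt; exact/negP.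
  by rewrite -(fineK f2) lee_fin leNgt lt22.
have fpi D : measurable D -> pi D \is a fin_num by exact: fin_num_measure.
have o20 : (0 <= fine (output_law M (P theta2) B))%R by exact: fine_ge0.
have q20 : (0 < ratr q2 :> R)%R by exact: le_lt_trans lt22.
have q10 : (0 < ratr q1 :> R)%R.
  by apply: le_lt_trans lt21; rewrite mulr_ge0// ltW.
have lo : (ratr q1)%:E * pi A' <= \int[pi]_(z in A') L z B.
  rewrite -integral_cst//; apply: ge0_le_integral => //.
  - by move=> z _; rewrite lee_fin ltW.
  - exact: measurable_funTS.
  - by move=> z /ltW.
have hi : \int[pi]_(z in A) L z B <= (ratr q2)%:E * pi A.
  rewrite -integral_cst//; apply: ge0_le_integral => //.
  - exact: measurable_funTS.
  - by move=> z /ltW.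
have : pi A * ((ratr q1)%:E * pi A') <= C%:E * (pi A' * ((ratr q2)%:E * pi A)).
  apply: (le_trans (lee_wpmul2l (measure_ge0 pi A) lo)).
  apply: (le_trans (cross A A' mA mA')).
  apply: lee_wpmul2l; first by rewrite lee_fin ltW.
  exact: lee_wpmul2l.
have a0 : (0 < fine (pi A))%R by rewrite fine_gt0// lt0e A0 measure_ge0 ltey_eq fpi.
have a'0 : (0 < fine (pi A'))%R.
  by rewrite fine_gt0// lt0e A'0 measure_ge0 ltey_eq fpi.
rewrite -(fineK (fpi _ mA)) -(fineK (fpi _ mA')) -!EFinM lee_fin leNgt => /negP.
apply; rewrite (_ : _ * _ = (ratr q2 * C) * (fine (pi A) * fine (pi A')))%R; last by ring.
rewrite [ltRHS](_ : _ = ratr q1 * (fine (pi A) * fine (pi A')))%R; last by ring.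
by rewrite ltr_pM2r ?mulr_gt0// -ltr_pdivlMr.
Qed.

End levels.

(** * Posteriors and the privacy guarantee *)

Section posteriors.
Context (R : realType) (dX dT dZ : measure_display) (X : measurableType dX)
  (T : measurableType dT) (Zs : measurableType dZ) (Theta : Type).
Variables (P : Theta -> probability X R) (c : conditioning X Theta)
  (Z : {mfun X >-> Zs}) (M : mechanism R X T) (theta : Theta).

Local Notation pi := (distribution (P theta) Z).
Local Notation pT := (output_law M (P theta)).

Lemma pker_le1 d d' (U : measurableType d) (V : measurableType d')
  (Q : R.-pker U ~> V) u (A : set V) : measurable A -> Q u A <= 1.
Proof. by move=> mA; rewrite -(prob_kernel (s := Q) u) le_measure ?inE. Qed.

Lemma integrable_pker (mu : probability T R) (Q : R.-pker T ~> Zs) A :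
  measurable A -> mu.-integrable [set: T] (Q ^~ A).
Proof.
move=> mA; apply/integrableP; split; first exact: measurable_kernel.
apply: (@le_lt_trans _ _ (\int[mu]_t cst 1 t)).
  apply: ge0_le_integral => //.
  - by apply: measurableT_comp => //; exact: measurable_kernel.
  - by move=> t _; rewrite gee0_abs//= pker_le1.
by rewrite integral_cst// mul1e [X in X < _]probability_setT ltry.
Qed.

(** When the levels have a countably generated sigma-algebra, the posterior is
    unique up to a null set of outputs. *)
Lemma is_posterior_unique (Q Q' : R.-pker T ~> Zs) : countably_generated Zs ->
  is_posterior P Z M theta Q -> is_posterior P Z M theta Q' ->
  {ae pT, forall t, forall A, measurable A -> Q t A = Q' t A}.
Proof.
move=> cg hQ hQ'; have [A [ringA AT mA gA]] := countably_generated_algebra cg.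
have mA' : range A `<=` measurable by move=> _ [n _ <-].
have : {ae pT, forall t, forall n, Q t (A n) = Q' t (A n)}.
  apply/ae_foralln => n.
  have : ae_eq pT setT (Q ^~ (A n)) (Q' ^~ (A n)).
    apply: integral_ae_eq => //; first exact: integrable_pker.
      exact: measurable_kernel.
    by move=> B _ mB; rewrite hQ// hQ'.
  by apply: filterS => t /(_ I).
apply: filterS => t QQ' B mB.
apply: (@measure_eq_algebra _ _ _ (kernel_law Q t) (kernel_law Q' t) _
  ringA AT mA' gA _ _ mB).
by move=> _ [n _ <-]; exact: QQ'.
Qed.

Lemma posterior_in_nbhd_unique (eps : \bar R) (Q Q' : R.-pker T ~> Zs) :
  countably_generated Zs ->
  is_posterior P Z M theta Q -> is_posterior P Z M theta Q' ->
  posterior_in_nbhd P Z M eps theta Q' -> posterior_in_nbhd P Z M eps theta Q.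
Proof.
move=> cg hQ hQ' nQ'; apply: filterS2 nQ' (is_posterior_unique cg hQ hQ') => t.
move=> [_ dr] QQ'; split; first exact: sigma_finite_pker.
by rewrite (d_DR_eq _ QQ').
Qed.

(** A posterior within [e] of the prior, integrated over an output event. *)
Lemma posterior_cross (e : R) (Q : R.-pker T ~> Zs) :
  is_posterior P Z M theta Q -> posterior_in_nbhd P Z M e%:E theta Q ->
  forall A A' B, measurable A -> measurable A' -> measurable B ->
  pi A * \int[P theta]_(x in Z @^-1` A') release_law M x B <=
  (expR e)%:E * (pi A' * \int[P theta]_(x in Z @^-1` A) release_law M x B).
Proof.
move=> hQ nQ A A' B mA mA' mB; rewrite -!hQ//.
have mQ D : measurable D -> measurable_fun B (Q ^~ D).
  by move=> mD; apply: measurable_funTS; exact: measurable_kernel.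
have fpi D : measurable D -> exists2 r, (0 <= r)%R & pi D = r%:E.
  move=> mD; have fD : pi D \is a fin_num by exact: fin_num_measure.
  by exists (fine (pi D)); rewrite ?fine_ge0 ?fineK.
have [[a a0 piA] [a' a'0 piA']] := (fpi _ mA, fpi _ mA').
rewrite piA piA'.
rewrite -!ge0_integralZl//; do ?[exact: mQ|exact: measurable_funeM];
  rewrite ?lee_fin ?expR_ge0//; last by move=> t _; rewrite mule_ge0.
  2: by apply: measurable_funeM; exact: mQ.
apply: ae_ge0_le_integral => //.
- by move=> t _; rewrite mule_ge0.
- by apply: measurable_funeM; exact: mQ.
- by move=> t _; rewrite mule_ge0 ?lee_fin ?expR_ge0// mule_ge0.
- by do 2 apply: measurable_funeM; exact: mQ.
apply: filterS nQ => t [_ dr] _; rewrite -piA -piA'.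
apply: d_DR_cross => //; first exact: expR_gt0.
- exact: probability_setT.
- exact: prob_kernel.
- by rewrite expRK.
Qed.

End posteriors.

Section pufferfish_posterior.
Context (R : realType) (dX dT dZ : measure_display) (X : measurableType dX)
  (T : measurableType dT) (Zs : measurableType dZ) (Theta : Type).
Variables (P : Theta -> probability X R) (c : conditioning X Theta)
  (Z : {mfun X >-> Zs}) (M : mechanism R X T) (D : set Theta)
  (SX : set (set X)).
Hypothesis SXm : forall E, SX E -> measurable E.
Hypothesis SXp : partition SX id [set: X].

Lemma partition_fibre x : (forall E, SX E -> exists z, E = fibre Z z) ->
  SX (fibre Z (Z x)).
Proof.
move=> SXf; have [cover _ _] := SXp.
have : [set: X] x by [].
rewrite -cover => -[E SXE Ex].
by have [z Ez] := SXf _ SXE; move: Ex SXE; rewrite /= Ez => <-.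
Qed.

(** Any two defined levels of [Z] are the ends of an edge, so the output laws at
    these levels dominate each other up to the factor [expR e]. *)
Lemma pufferfish_posterior_version (e : R) (theta : Theta) : (0 <= e)%R ->
  D theta -> given_by_density P c Z SX theta ->
  pufferfish P c e%:E D (SX `*` SX) M ->
  exists Q : R.-pker T ~> Zs, is_posterior P Z M theta Q /\
    posterior_in_nbhd P Z M e%:E theta Q.
Proof.
move=> e0 Dth [SXf _ [k [kE ck cdef]]] /(pufferfish_edge_bound e0) edges.
have edge z z' th1 th2 : c theta (fibre Z (Z z)) = Some th1 ->
    c theta (fibre Z (Z z')) = Some th2 -> pf_edge c D (SX `*` SX) th1 th2.
  move=> c1 c2; exists theta, (fibre Z (Z z)), (fibre Z (Z z')); split => //.
  by split; exact: partition_fibre.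
have [|||Q [QE Qdr]] := @posterior_version _ _ _ _ _ (distribution (P theta) Z)
    (level_law M k) (output_law M (P theta)) _ (expR e)
    (defined_levels c Z theta) (expR_gt0 e).
- by move=> B mB; exact: output_law_mixture.
- exact: thick_defined_levels.
- move=> z z' [x Zx] + [x' Zx'] + B mB; rewrite -{}Zx -{}Zx'.
  case cx : (c _ _) => [th1|]// _; case cx' : (c _ _) => [th2|]// _.
  have [le _] := edges _ _ (edge _ _ _ _ cx cx') _ mB.
  by rewrite -(output_law_level M ck cx) -(output_law_level M ck cx').
exists Q; split => [A B mA mB|]; first by rewrite QE// (integral_release_law M kE).
apply: filterS Qdr => t dr; split; first exact: sigma_finite_pker.
by rewrite -[e]expRK.
Qed.

(** The output laws of two conditionals are compared on an event at which neither
    conditional lies outside of the essential range over the levels. *)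
Lemma posterior_output_law_le (e : R) (theta th1 th2 : Theta) B :
  given_by_density P c Z SX theta ->
  (exists Q : R.-pker T ~> Zs, is_posterior P Z M theta Q /\
     posterior_in_nbhd P Z M e%:E theta Q) ->
  measurable B ->
  (forall q : rat, unexceptional_at P c Z M theta th1 B (ratr q)%:E) ->
  (forall q : rat, unexceptional_at P c Z M theta th2 B (ratr q)%:E) ->
  output_law M (P th1) B <= (expR e)%:E * output_law M (P th2) B.
Proof.
move=> [_ _ [k [kE ck _]]] [Q [QP Qn]] mB u1 u2.
apply: (unexceptional_output_law_le ck (expR_gt0 e) mB _ u1 u2).
move=> A A' mA mA'; rewrite -!(integral_release_law M kE)//.
exact: posterior_cross QP Qn _ _ _ mA mA' mB.
Qed.

Hypothesis Dgiven : forall theta, D theta -> given_by_density P c Z SX theta.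

Lemma edge_unexceptional (theta theta' : Theta) E : D theta -> SX E ->
  c theta E = Some theta' -> 0 < P theta E -> unexceptional P c Z M theta theta'.
Proof.
move=> Dth SXE cE PE; have [SXf _ _] := Dgiven Dth; have [z Ez] := SXf _ SXE.
have mE := SXm SXE; move: cE PE mE; rewrite Ez => cE PE mE.
exact: positive_unexceptional mE cE PE.
Qed.

Lemma posterior_pufferfish (eps : \bar R) : 0 <= eps ->
  (forall theta, D theta -> exists Q : R.-pker T ~> Zs,
     is_posterior P Z M theta Q /\ posterior_in_nbhd P Z M eps theta Q) ->
  (forall theta E theta', D theta -> SX E -> c theta E = Some theta' ->
     0 < P theta E \/ unexceptional P c Z M theta theta') ->
  pufferfish P c eps D (SX `*` SX) M.
Proof.
case: eps => [e| |]; last by rewrite leeNy_eq.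
  rewrite lee_fin => e0 post uexc; apply: edge_bound_pufferfish => //.
  move=> th1 th2 [theta [E1 [E2 [Dth [/= S1 S2] c1 c2]]]] B mB.
  have unexc th E : SX E -> c theta E = Some th ->
      forall q : rat, unexceptional_at P c Z M theta th B (ratr q)%:E.
    move=> SE cE q; have [PE|ue] := uexc _ _ _ Dth SE cE; last exact: ue.
    exact: (edge_unexceptional Dth SE cE PE).
  by split; apply: (posterior_output_law_le (Dgiven Dth) (post _ Dth) mB);
    eauto.
by move=> *; exact: pufferfishy.
Qed.

(** The conditionals on null events that are kept are unexceptional on a countable
    algebra of output events and for rational bounds; this discards only null
    many of them. The domination of output laws, unlike being unexceptional,
    passes from the algebra to all output events. *)
Lemma posterior_pufferfish_discards (eps : \bar R) : 0 <= eps ->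
  (forall theta, D theta -> exists Q : R.-pker T ~> Zs,
     is_posterior P Z M theta Q /\ posterior_in_nbhd P Z M eps theta Q) ->
  countably_generated T ->
  exists c' : conditioning X Theta,
    [/\ discards_null P c c',
        forall theta, D theta ->
          {ae P theta, forall x,
             c' theta (fibre Z (Z x)) = c theta (fibre Z (Z x))}
      & pufferfish P c' eps D (SX `*` SX) M].
Proof.
move=> eps0 post cg; have [A [ringA AT mA gA]] := countably_generated_algebra cg.
have mA' : range A `<=` measurable by move=> _ [n _ <-].
pose typical theta th' := forall n (q : rat),
  unexceptional_at P c Z M theta th' (A n) (ratr q)%:E.
pose keep theta E := 0 < P theta E \/
  exists2 th', c theta E = Some th' & typical theta th'.
exists (fun theta E => if `[< keep theta E >] then c theta E else None).
split.
- move=> theta E; case: asboolP => [_|nkeep]; [by left|right; split => //].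
  apply/eqP; rewrite eq_le measure_ge0 andbT leNgt; apply/negP => PE.
  by apply: nkeep; left.
- move=> theta _.
  have : {ae P theta, forall x, forall i, if unpickle i is Some nq then
      forall th', c theta (fibre Z (Z x)) = Some th' ->
      unexceptional_at P c Z M theta th' (A nq.1) (ratr (nq.2 : rat))%:E
      else True}.
    apply/ae_foralln => i; case: unpickle => [nq|]; last exact: aeW.
    exact: ae_unexceptional_at.
  apply: filterS => x ux; case: asboolP => // nkeep.
  case cx : (c _ _) => [th'|//]; exfalso; apply: nkeep; right; exists th' => //.
  by move=> n q; have := ux (pickle (n, q)); rewrite pickleK; apply.
- case: eps eps0 post => [e| |]; last by rewrite leeNy_eq.
    rewrite lee_fin => e0 post; apply: edge_bound_pufferfish => //.
    move=> th1 th2 [theta [E1 [E2 [Dth [/= S1 S2]]]]].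
    case: asboolP => // k1 c1; case: asboolP => // k2 c2.
    have typ th E : SX E -> c theta E = Some th -> keep theta E ->
        typical theta th.
      move=> SE cE [PE|[th' cth' tth']]; last by move: cth'; rewrite cE => -[->].
      by move=> n q; apply: (edge_unexceptional Dth SE cE PE).
    have t1 := typ _ _ S1 c1 k1; have t2 := typ _ _ S2 c2 k2.
    move=> B mB; split; apply: (measure_le_algebra ringA AT mA' gA _ mB);
      move=> _ [n _ <-];
      exact: (posterior_output_law_le (Dgiven Dth) (post _ Dth) (mA n)).
  by move=> *; exact: pufferfishy.
Qed.

End pufferfish_posterior.

Theorem theorem23 (R : realType)
    (dX dT dZ : measure_display) (X : measurableType dX)
    (T : measurableType dT) (Zs : measurableType dZ)
    (Theta : Type) (P : Theta -> probability X R) (G : Theta -> R -> X)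
    (hP : parametrization P) (hG : data_generating P G)
    (M : mechanism R X T)
    (c : conditioning X Theta) (hc : elementary_conditioning P c)
    (eps : \bar R) (heps : 0 <= eps)
    (D : set Theta) (S : set (set X * set X))
    (thetas : Theta) (hthetas : D thetas)
    (SX : set (set X)) (hSXm : forall E, SX E -> measurable E)
    (hSX : partition SX id [set: X]) (hS : S = SX `*` SX)
    (Z : {mfun X >-> Zs}) (hZ : given_by_density P c Z SX thetas) :
  (pufferfish P c eps D S M ->
     (forall Q0 : R.-pker T ~> Zs, is_posterior P Z M thetas Q0 ->
        exists Q : R.-pker T ~> Zs,
          is_posterior P Z M thetas Q /\
          posterior_in_nbhd P Z M eps thetas Q) /\
     (countably_generated Zs ->
        forall Q : R.-pker T ~> Zs, is_posterior P Z M thetas Q ->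
          posterior_in_nbhd P Z M eps thetas Q)) /\
  ((forall theta, D theta -> given_by_density P c Z SX theta) ->
   (forall theta, D theta -> exists Q : R.-pker T ~> Zs,
      is_posterior P Z M theta Q /\ posterior_in_nbhd P Z M eps theta Q) ->
     ((forall theta E theta', D theta -> SX E -> c theta E = Some theta' ->
         0 < P theta E \/ unexceptional P c Z M theta theta') ->
        pufferfish P c eps D S M) /\
     (countably_generated T ->
        exists c' : conditioning X Theta,
          [/\ discards_null P c c',
              forall theta, D theta ->
                {ae P theta, forall x,
                   c' theta (fibre Z (Z x)) = c theta (fibre Z (Z x))}
            & pufferfish P c' eps D S M])).
Proof.
rewrite {}hS; split=> [pf|given post]; last first.
  by split; [exact: posterior_pufferfish|exact: posterior_pufferfish_discards].
suff ex (Q0 : R.-pker T ~> Zs) : is_posterior P Z M thetas Q0 ->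
    exists Q : R.-pker T ~> Zs, is_posterior P Z M thetas Q /\
      posterior_in_nbhd P Z M eps thetas Q.
  split=> // cg Q hQ; have [Q' [hQ' nQ']] := ex Q hQ.
  exact: posterior_in_nbhd_unique cg hQ hQ' nQ'.
case: eps heps pf => [e| |]; last by rewrite leeNy_eq.
  by rewrite lee_fin => e0 pf _; exact: (pufferfish_posterior_version hSX e0 hthetas hZ pf).
move=> _ _ hQ0; exists Q0; split=> //.
by apply: aeW => t; split; [exact: sigma_finite_pker|rewrite leey].
Qed.
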